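(* Let $\kappa_0\ge1$ be fixed and assume $\kappa\le\kappa_0$. Let $c_d\ge 2$. There is a constant $c_0>0$ such that if $p>\frac{c_0\log n}{n}$ and $d=c_d np$, then with probability at least $1-O(n^{-5})$ the spectral estimate $\pi$ satisfies $$\frac{\|\pi-\pi^*\|_\infty}{\|\pi^*\|_\infty}\le C\sqrt{\frac{\log n}{npL}},$$ where $C$ depends only on $\kappa_0$ and $c_d$.
   Context: Bradley–Terry–Luce (BTL) setup. There are $n$ items with unknown preference scores $w_1^*\ge w_2^*\ge\cdots\ge w_n^*>0$, all lying in $[w_{\min},w_{\max}]$ with $w_{\min}>0$; set $\theta_i^*=\log w_i^*$ and $\kappa=w_{\max}/w_{\min}$. A comparison graph $\mathcal G=(\{1,\dots,n\},\mathcal E)$ is drawn from the Erdős–Rényi model $\mathcal G_{n,p}$ (each unordered pair is an edge independently with probability $p$). For each edge $(i,j)\in\mathcal E$ one observes $L$ comparisons $y_{i,j}^{(l)}$, $l=1,\dots,L$, where $y_{i,j}^{(l)}=1$ with probability $y^*_{i,j}:=\frac{w_j^*}{w_i^*+w_j^*}$ and $0$ otherwise, with the convention $y_{j,i}^{(l)}=1-y_{i,j}^{(l)}$; all comparisons are mutually independent and independent of $\mathcal G$. Let $y_{i,j}=\frac1L\sum_{l=1}^L y_{i,j}^{(l)}$. Spectral method: for $d>0$ define $P$ by $P_{i,j}=\frac1d y_{i,j}$ if $(i,j)\in\mathcal E$, $P_{i,i}=1-\frac1d\sum_{k:(i,k)\in\mathcal E}y_{i,k}$, and $P_{i,j}=0$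 otherwise; $\pi$ is the stationary distribution of $P$ (leading left eigenvector normalized to sum to $1$). The normalized score vector is $\pi^*=\frac{1}{\sum_i w_i^*}(w_1^*,\dots,w_n^* )^\top$. *)

(* Defs.v *)
From Stdlib Require Import Reals Arith ClassicalEpsilon.
Open Scope R_scope.

Fixpoint rsum (n : nat) (f : nat -> R) : R :=
  match n with O => 0 | S k => rsum k f + f k end.

Fixpoint linf (n : nat) (v : nat -> R) : R :=
  match n with O => 0 | S k => Rmax (linf k v) (Rabs (v k)) end.

Definition indic (P : Prop) : R :=
  if excluded_middle_informative P then 1 else 0.

(* Expectation of F over independent Bernoulli variables g 0, ..., g (m-1),
   with P(g k = true) = q k  (variables of index >= m are fixed to false). *)
Fixpoint bexp (m : nat) (q : nat -> R) (F : (nat -> bool) -> R) : R :=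
  match m with
  | O => F (fun _ => false)
  | S k => q k * bexp k q (fun g => F (fun i => if Nat.eqb i k then true else g i))
         + (1 - q k) * bexp k q (fun g => F (fun i => if Nat.eqb i k then false else g i))
  end.

(* Encoding of the random experiment as a family of independent bits g.
   Items are 0..n-1.  For i<j<n:
   - edge bit of pair {i,j}            : index  i*n+j          (prob p)
   - l-th comparison bit y_{i,j}^{(l)} : index  n*n + (i*n+j)*L + l, l<L
                                         (prob w j / (w i + w j)).
   Unused indices get probability 0 (they are irrelevant). *)
Definition nvars (n L : nat) : nat := (n * n + n * n * L)%nat.

Definition bprob (n L : nat) (p : R) (w : nat -> R) (k : nat) : R :=
  if Nat.ltb k (n * n)%nat then
    (if Nat.ltb (Nat.div k n) (Nat.modulo k n) then p else 0)
  else
    let pr := Nat.div (k - n * n)%nat L in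
    let i := Nat.div pr n in let j := Nat.modulo pr n in
    if Nat.ltb i j then w j / (w i + w j) else 0.

Definition edge (n : nat) (g : nat -> bool) (i j : nat) : bool :=
  if Nat.ltb i j then g (i * n + j)%nat
  else if Nat.ltb j i then g (j * n + i)%nat else false.

Definition ybit (n L : nat) (g : nat -> bool) (i j l : nat) : bool :=
  if Nat.ltb i j then g (n * n + (i * n + j) * L + l)%nat
  else negb (g (n * n + (j * n + i) * L + l)%nat).

Definition b2R (b : bool) : R := if b then 1 else 0.

Definition yavg (n L : nat) (g : nat -> bool) (i j : nat) : R :=
  rsum L (fun l => b2R (ybit n L g i j l)) / INR L.

Definition Pmat (n L : nat) (d : R) (g : nat -> bool) (i j : nat) : R :=
  if Nat.eqb i j then
    1 - / d * rsum n (fun k => if edge n g i k then yavg n L g i k else 0)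
  else if edge n g i j then yavg n L g i j / d else 0.

Definition stationary (n : nat) (P : nat -> nat -> R) (pi : nat -> R) : Prop :=
  (forall i, (i < n)%nat -> 0 <= pi i) /\
  rsum n pi = 1 /\
  (forall j, (j < n)%nat -> rsum n (fun i => pi i * P i j) = pi j).

Definition pistar (n : nat) (w : nat -> R) (i : nat) : R := w i / rsum n w.

(* Main.v *)
(* Write f i j for y_{i,j} on the edges and 0 elsewhere, and x = pi / w.  Stationarity does not
   involve d: it says lap x = 0, where lap x m = sum_i (w_m x_m f m i - w_i x_i f i m).
   Since f i j + f j i is the edge indicator, the quadratic form z . lap z is at least a multiple of
   the Dirichlet form of the unweighted graph, up to the diagonal term (1/2) sum_m z_m^2 (lap 1)_m,
   which Hoeffding's inequality controls.  The spectral gap of the graph comes from Cheeger's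
   argument and a union bound over cuts, so no matrix concentration is needed.
   With D = n p and tau = sqrt (ln n / (D L)), coercivity gives |x - 1|_2 = O(tau sqrt n).  For the
   entrywise bound, let eta be the error of the solution with the edges at m removed.  It does not
   depend on the edges at m, so by Chernoff its l1 mass on the neighbours of m is
   O(p |eta|_1 + ln n |eta|_oo); this bounds |x - 1 - eta|_2 by coercivity, and then |x_m - 1|
   through the m-th balance equation, the term in |x - 1|_oo having a small factor because
   D >= c0 ln n. *)
Require Import Defs.
From Stdlib Require Import Reals Arith ClassicalEpsilon.
From Stdlib Require Import Lra Lia Psatz List FunctionalExtensionality.
Open Scope R_scope.

(** * Finite sums and norms *)

(** Two points shape the argument beyond the outline. Independence is expressed without conditional
    probability: the error [eta m] is selected by [epsilon] from a predicate that sees only the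
    flows with [m] deleted, so it is literally a function of the other bits, and exponential moments
    are bounded against every nonnegative test function of those bits. The estimates are also
    circular: the mass [T] of [eta m] near [m] bounds the distance between [x - 1] and [eta m],
    while the size of [eta m] is only known through that distance and through the sup norm of
    [x - 1]. Each loop carries a factor [/ M], coming either from [M <= sqrt n] or from
    [M * ln n <= D], and is absorbed. The fourth power of [K] in [M] is a product: one factor from
    the weights in the balance equation at [m], one from the coupling of [x - 1 - eta] to [T], and
    two from the l2 bound on [x - 1]. All weights are first scaled into [[1, K]]. *)

Lemma rsum_ext n f g : (forall i, (i < n)%nat -> f i = g i) -> rsum n f = rsum n g.
Proof.
  induction n as [|n IH]; intros H; simpl; [reflexivity|].
  rewrite IH by (intros; apply H; lia). now rewrite H by lia.
Qed.

Lemma rsum_le n f g : (forall i, (i < n)%nat -> f i <= g i) -> rsum n f <= rsum n g.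
Proof.
  induction n as [|n IH]; intros H; simpl; [lra|].
  apply Rplus_le_compat; [apply IH; intros; apply H; lia | apply H; lia].
Qed.

Lemma rsum_0 n : rsum n (fun _ => 0) = 0.
Proof. induction n; simpl; lra. Qed.

Lemma rsum_const n c : rsum n (fun _ => c) = INR n * c.
Proof. induction n; [simpl; lra|]. rewrite S_INR; simpl; lra. Qed.

Lemma rsum_plus n f g : rsum n (fun i => f i + g i) = rsum n f + rsum n g.
Proof. induction n; simpl; lra. Qed.

Lemma rsum_minus n f g : rsum n (fun i => f i - g i) = rsum n f - rsum n g.
Proof. induction n; simpl; lra. Qed.

Lemma rsum_scal n c f : rsum n (fun i => c * f i) = c * rsum n f.
Proof. induction n as [|n IH]; simpl; [|rewrite IH]; lra. Qed.

Lemma rsum_nonneg n f : (forall i, (i < n)%nat -> 0 <= f i) -> 0 <= rsum n f.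
Proof. intros H. rewrite <- (rsum_0 n). now apply rsum_le. Qed.

Lemma rsum_abs n f : Rabs (rsum n f) <= rsum n (fun i => Rabs (f i)).
Proof.
  induction n as [|n IH]; simpl; [rewrite Rabs_R0; lra|].
  eapply Rle_trans; [apply Rabs_triang|lra].
Qed.

Lemma rsum_swap n m (f : nat -> nat -> R) :
  rsum n (fun i => rsum m (fun j => f i j)) = rsum m (fun j => rsum n (fun i => f i j)).
Proof.
  induction n as [|n IH]; simpl; [now rewrite rsum_0|].
  now rewrite IH, <- rsum_plus.
Qed.

Lemma rsum_split n m f : (m < n)%nat ->
  rsum n f = f m + rsum n (fun i => if Nat.eqb i m then 0 else f i).
Proof.
  induction n as [|n IH]; intros H; [lia|]. simpl.
  destruct (Nat.eqb_spec n m) as [->|Hn].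
  - rewrite (rsum_ext m f (fun i => if Nat.eqb i m then 0 else f i)); [lra|].
    intros i Hi. destruct (Nat.eqb_spec i m); [lia|reflexivity].
  - rewrite IH by lia. lra.
Qed.

Lemma rsum_term_le n f k : (k < n)%nat -> (forall i, (i < n)%nat -> 0 <= f i) -> f k <= rsum n f.
Proof.
  intros Hk H. rewrite (rsum_split n k) by easy.
  enough (0 <= rsum n (fun i => if Nat.eqb i k then 0 else f i)) by lra.
  apply rsum_nonneg. intros i Hi. destruct (Nat.eqb i k); [lra|auto].
Qed.

Definition norm2 (n : nat) (z : nat -> R) : R := sqrt (rsum n (fun i => z i * z i)).

Lemma sumsq_nonneg n z : 0 <= rsum n (fun i => z i * z i).
Proof. apply rsum_nonneg. intros; nra. Qed.

Lemma norm2_nonneg n z : 0 <= norm2 n z.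
Proof. apply sqrt_pos. Qed.

Lemma norm2_sqr n z : norm2 n z * norm2 n z = rsum n (fun i => z i * z i).
Proof. apply sqrt_sqrt, sumsq_nonneg. Qed.

Lemma norm2_le n z b : 0 <= b -> rsum n (fun i => z i * z i) <= b * b -> norm2 n z <= b.
Proof.
  intros Hb H. unfold norm2. rewrite <- (sqrt_square b) by easy. now apply sqrt_le_1_alt.
Qed.

Lemma abs_le_norm2 n z k : (k < n)%nat -> Rabs (z k) <= norm2 n z.
Proof.
  intros Hk. unfold norm2. rewrite <- sqrt_Rsqr_abs. apply sqrt_le_1_alt.
  apply (rsum_term_le n (fun i => z i * z i)); [easy|intros; nra].
Qed.

Lemma cauchy_schwarz n u v :
  rsum n (fun i => Rabs (u i) * Rabs (v i)) <= norm2 n u * norm2 n v.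
Proof.
  set (s := rsum n (fun i => Rabs (u i) * Rabs (v i))).
  assert (Hq : forall t, 0 <= norm2 n u * norm2 n u + 2 * t * s + t * t * (norm2 n v * norm2 n v)).
  { intros t. rewrite !norm2_sqr. unfold s.
    rewrite <- !rsum_scal, <- !rsum_plus. apply rsum_nonneg. intros i _.
    replace (u i * u i) with (Rabs (u i) * Rabs (u i)) by (unfold Rabs; destruct (Rcase_abs (u i)); nra).
    replace (v i * v i) with (Rabs (v i) * Rabs (v i)) by (unfold Rabs; destruct (Rcase_abs (v i)); nra).
    replace (_ + _) with ((Rabs (u i) + t * Rabs (v i)) * (Rabs (u i) + t * Rabs (v i))) by ring.
    apply Rle_0_sqr. }
  pose proof (norm2_nonneg n u) as Hu. pose proof (norm2_nonneg n v) as Hv.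
  assert (Hs : 0 <= s) by (apply rsum_nonneg; intros; apply Rmult_le_pos; apply Rabs_pos).
  destruct (Req_dec (norm2 n v) 0) as [E|E].
  - assert (s <= 0); [|rewrite E; lra].
    destruct (Rle_lt_dec s 0) as [|Hp]; [easy|exfalso].
    (* With [norm2 n v = 0] the quadratic is affine in [t], and this [t] gives it the value -1. *)
    specialize (Hq (- (norm2 n u * norm2 n u + 1) / (2 * s))). rewrite E in Hq.
    replace (2 * (- (norm2 n u * norm2 n u + 1) / (2 * s)) * s)
      with (- (norm2 n u * norm2 n u + 1)) in Hq by (field; lra). lra.
  (* This [t] makes the two square terms equal, so the inequality factors as [norm2 n u * (norm2 n u
     * norm2 n v - s) >= 0]. *)
  - specialize (Hq (- norm2 n u / norm2 n v)).
    replace (- norm2 n u / norm2 n v * (- norm2 n u / norm2 n v) * (norm2 n v * norm2 n v))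
      with (norm2 n u * norm2 n u) in Hq by (field; easy).
    assert (Hm : norm2 n u * (norm2 n u * norm2 n v - s) >= 0).
    { replace (norm2 n u * (norm2 n u * norm2 n v - s)) with
        (norm2 n v / 2 * (norm2 n u * norm2 n u + 2 * (- norm2 n u / norm2 n v) * s + norm2 n u * norm2 n u))
        by (field; easy).
      apply Rle_ge, Rmult_le_pos; lra. }
    destruct (Req_dec (norm2 n u) 0) as [E'|E']; [|nra].
    assert (s <= 0); [|nra]. apply Rle_trans with (rsum n (fun _ => 0)); [|rewrite rsum_0; lra].
    apply rsum_le. intros i Hi. pose proof (abs_le_norm2 n u i Hi). pose proof (Rabs_pos (u i)).
    replace (Rabs (u i)) with 0 by lra. lra.
Qed.

Lemma norm2_triangle n u v z : (forall i, (i < n)%nat -> z i = u i + v i) ->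
  norm2 n z <= norm2 n u + norm2 n v.
Proof.
  intros E. pose proof (norm2_nonneg n u). pose proof (norm2_nonneg n v).
  apply norm2_le; [lra|].
  pose proof (cauchy_schwarz n u v) as CS. pose proof (norm2_sqr n u). pose proof (norm2_sqr n v).
  assert (rsum n (fun i => z i * z i) <= rsum n (fun i => u i * u i) +
     2 * rsum n (fun i => Rabs (u i) * Rabs (v i)) + rsum n (fun i => v i * v i)); [|nra].
  rewrite <- rsum_scal, <- !rsum_plus. apply rsum_le. intros i Hi. rewrite E by easy.
  rewrite <- Rabs_mult. pose proof (Rle_abs (u i * v i)). nra.
Qed.

Lemma sum_abs_le_norm2 n u : rsum n (fun i => Rabs (u i)) <= sqrt (INR n) * norm2 n u.
Proof.
  eapply Rle_trans; [|eapply Rle_trans; [apply (cauchy_schwarz n (fun _ => 1) u)|]].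
  - apply rsum_le. intros. rewrite Rabs_R1. lra.
  - unfold norm2 at 1. rewrite rsum_const. replace (INR n * (1 * 1)) with (INR n) by ring. lra.
Qed.

Lemma linf_ge n v k : (k < n)%nat -> Rabs (v k) <= linf n v.
Proof.
  induction n as [|n IH]; intros H; [lia|]. simpl.
  destruct (Nat.eq_dec k n) as [->|]; [apply Rmax_r|].
  eapply Rle_trans; [apply IH; lia|apply Rmax_l].
Qed.

Lemma linf_le n v b : 0 <= b -> (forall k, (k < n)%nat -> Rabs (v k) <= b) -> linf n v <= b.
Proof.
  induction n as [|n IH]; intros Hb H; simpl; [easy|].
  apply Rmax_lub; [apply IH; auto|apply H; lia].
Qed.

Lemma linf_nonneg n v : 0 <= linf n v.
Proof.
  destruct n; simpl; [lra|]. eapply Rle_trans; [apply Rabs_pos|apply Rmax_r].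
Qed.

(** Gaussian elimination. The free unknowns are carried as a list [l], so that eliminating a pivot
    just removes it from [l]; unknowns outside [l] stay zero. *)
Lemma homogeneous_system n (k : nat) : forall (eqs : list (nat -> R)) (l : list nat),
  length eqs = k -> NoDup l -> (forall i, In i l -> (i < n)%nat) -> (k < length l)%nat ->
  exists u, (exists j, In j l /\ u j <> 0) /\ (forall j, ~ In j l -> u j = 0) /\
    forall c, In c eqs -> rsum n (fun j => c j * u j) = 0.
Proof.
  induction k as [|k IH]; intros eqs l Hk Hnd Hn Hlen.
  - destruct eqs; [|discriminate]. destruct l as [|j0 l]; [simpl in Hlen; lia|].
    exists (fun j => if Nat.eqb j j0 then 1 else 0). split; [|split].
    + exists j0. split; [now left|]. rewrite Nat.eqb_refl. lra.
    + intros j Hj. destruct (Nat.eqb_spec j j0) as [->|]; [|reflexivity].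
      now destruct Hj; left.
    + intros c [].
  - destruct eqs as [|c eqs]; [discriminate|]. injection Hk as Hk.
    destruct (excluded_middle_informative (exists j, In j l /\ c j <> 0)) as [[j0 [Hj0 Hc]]|Hno].
    + assert (Hj0n := Hn _ Hj0).
      destruct (in_split _ _ Hj0) as [l1 [l2 ->]].
      pose proof (NoDup_remove_1 _ _ _ Hnd) as Hnd'.
      pose proof (NoDup_remove_2 _ _ _ Hnd) as Hnin.
      (* Row operation that clears column [j0] by means of the pivot row [c]; the value at [j0] is
         restored afterwards from the equation [c]. *)
      set (elim := fun (r : nat -> R) j => r j - r j0 * c j / c j0).
      rewrite length_app in Hlen. simpl in Hlen.
      destruct (IH (map elim eqs) (l1 ++ l2)) as [u [[j1 [Hj1 Hu1]] [Hsupp Hu]]]; auto.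
      * now rewrite length_map.
      * intros i Hi. apply Hn. rewrite in_app_iff in *. simpl. tauto.
      * rewrite length_app. lia.
      * set (s := rsum n (fun j => c j * u j)).
        exists (fun j => if Nat.eqb j j0 then - s / c j0 else u j).
        assert (Hsum : forall r : nat -> R,
          rsum n (fun j => r j * (if Nat.eqb j j0 then - s / c j0 else u j))
          = rsum n (fun j => r j * u j) - r j0 * s / c j0).
        { intros r. rewrite (rsum_split n j0 _ Hj0n), Nat.eqb_refl.
          rewrite (rsum_split n j0 (fun j => r j * u j) Hj0n), (Hsupp j0 Hnin).
          rewrite (rsum_ext n _ (fun j => if Nat.eqb j j0 then 0 else r j * u j)); [field; easy|].
          intros i _. now destruct (Nat.eqb i j0). }
        split; [|split].
        -- exists j1. split; [rewrite in_app_iff in *; simpl; tauto|].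
           destruct (Nat.eqb_spec j1 j0) as [->|]; [now destruct Hnin|easy].
        -- intros j Hj. destruct (Nat.eqb_spec j j0) as [->|]; [now destruct Hj|].
           apply Hsupp. rewrite in_app_iff in *. simpl in Hj. tauto.
        -- intros r [<-|Hr]; rewrite Hsum; [fold s; field; easy|].
           specialize (Hu (elim r) (in_map elim _ _ Hr)). unfold elim in Hu.
           rewrite (rsum_ext n _ (fun j => r j * u j - r j0 / c j0 * (c j * u j))) in Hu
             by (intros; field; easy).
           rewrite rsum_minus, rsum_scal in Hu. fold s in Hu.
           rewrite <- Hu. field; easy.
    (* Without a pivot, the equation [c] vanishes on [l] and holds for every vector supported
       there. *)
    + destruct (IH eqs l) as [u [Hne [Hsupp Hu]]]; auto; [lia|].
      exists u. split; [easy|split; [easy|]].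
      intros r [<-|Hr]; [|now apply Hu].
      rewrite <- (rsum_0 n). apply rsum_ext. intros j _.
      destruct (in_dec Nat.eq_dec j l) as [Hj|Hj]; [|rewrite Hsupp by easy; ring].
      destruct (Req_dec (c j) 0) as [->|E]; [ring|]. destruct Hno; eauto.
Qed.

(** * Spectral gap from cuts *)

(** The weights may be negative: with [a] the edge indicator minus [p / 4], nonnegativity on
    indicators says that every cut contains at least a quarter of its expected number of edges. *)
Definition dirichlet1 (n : nat) (a : nat -> nat -> R) (f : nat -> R) : R :=
  rsum n (fun i => rsum n (fun j => a i j * Rabs (f i - f j))).

Lemma min_positive n (f : nat -> R) :
  (forall i, (i < n)%nat -> f i <= 0) \/
  exists k, (k < n)%nat /\ 0 < f k /\ forall i, (i < n)%nat -> 0 < f i -> f k <= f i.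
Proof.
  induction n as [|n [IH|[k [Hk [Hp Hm]]]]].
  - left. intros; lia.
  - destruct (Rle_lt_dec (f n) 0) as [H|H].
    + left. intros i Hi. destruct (Nat.eq_dec i n) as [->|]; [easy|apply IH; lia].
    + right. exists n. split; [lia|split; [easy|]]. intros i Hi Hfi.
      destruct (Nat.eq_dec i n) as [->|]; [lra|]. specialize (IH i ltac:(lia)). lra.
  - right. destruct (Rle_lt_dec (f n) 0) as [H|H]; [|destruct (Rle_lt_dec (f k) (f n)) as [H'|H']].
    + exists k. split; [lia|split; [easy|]]. intros i Hi Hfi.
      destruct (Nat.eq_dec i n) as [->|]; [lra|apply Hm; [lia|easy]].
    + exists k. split; [lia|split; [easy|]]. intros i Hi Hfi.
      destruct (Nat.eq_dec i n) as [->|]; [lra|apply Hm; [lia|easy]].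
    + exists n. split; [lia|split; [easy|]]. intros i Hi Hfi.
      destruct (Nat.eq_dec i n) as [->|]; [lra|]. specialize (Hm i ltac:(lia) Hfi). lra.
Qed.

(* Layer-cake decomposition: peel off the lowest positive level of f. *)
Lemma dirichlet1_nonneg_levels n a :
  (forall S : nat -> bool, 0 <= dirichlet1 n a (fun i => b2R (S i))) ->
  forall k (l : list nat) f, (length l <= k)%nat -> (forall i, (i < n)%nat -> 0 <= f i) ->
  (forall i, (i < n)%nat -> 0 < f i -> In i l) -> 0 <= dirichlet1 n a f.
Proof.
  intros HS k. induction k as [|k IH]; intros l f Hl Hf Hin;
  (destruct (min_positive n f) as [Hz|[m [Hm [Hp Hmin]]]];
  [ unfold dirichlet1; rewrite (rsum_ext n _ (fun _ => 0)), rsum_0; [lra|];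
    intros i Hi; rewrite <- (rsum_0 n); apply rsum_ext; intros j Hj;
    replace (f i - f j) with 0;
      [rewrite Rabs_R0; ring|
       pose proof (Hf i Hi); pose proof (Hf j Hj); pose proof (Hz i Hi); pose proof (Hz j Hj); lra]
  | pose proof (Hin m Hm Hp) as Hml ]).
  - destruct l; [easy|simpl in Hl; lia].
  - set (S := fun i => if Rlt_dec 0 (f i) then true else false).
    set (f' := fun i => f i - f m * b2R (S i)).
    assert (Hf' : 0 <= dirichlet1 n a f').
    { apply (IH (remove Nat.eq_dec m l)).
      - pose proof (remove_length_lt Nat.eq_dec l m Hml). lia.
      - intros i Hi. unfold f', S, b2R. destruct (Rlt_dec 0 (f i)) as [H|H]; [|specialize (Hf i Hi); lra].
        specialize (Hmin i Hi H). lra.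
      - intros i Hi Hpos. apply in_in_remove.
        + intros ->. unfold f', S, b2R in Hpos. destruct (Rlt_dec 0 (f m)); lra.
        + apply Hin; [easy|]. unfold f', S, b2R in Hpos. destruct (Rlt_dec 0 (f i)); lra. }
    (* Truncation keeps the order of the values: [f'] and the indicator of [S] increase together, so
       their absolute differences add up exactly. *)
    assert (E : dirichlet1 n a f = dirichlet1 n a f' + f m * dirichlet1 n a (fun i => b2R (S i))).
    { unfold dirichlet1. rewrite <- rsum_scal, <- rsum_plus. apply rsum_ext. intros i Hi.
      rewrite <- rsum_scal, <- rsum_plus. apply rsum_ext. intros j Hj.
      assert (Rabs (f i - f j) = Rabs (f' i - f' j) + f m * Rabs (b2R (S i) - b2R (S j))) as ->; [|ring].
      pose proof (Hmin i Hi). pose proof (Hmin j Hj). pose proof (Hf i Hi). pose proof (Hf j Hj).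
      unfold f', S, b2R.
      destruct (Rlt_dec 0 (f i)) as [H3|H3], (Rlt_dec 0 (f j)) as [H4|H4];
        try specialize (H H3); try specialize (H0 H4);
        unfold Rabs; repeat destruct Rcase_abs; lra. }
    rewrite E. specialize (HS S). nra.
Qed.

(** A shift by [linf n f] makes the function nonnegative and changes no difference. *)
Lemma coarea n a : (forall S : nat -> bool, 0 <= dirichlet1 n a (fun i => b2R (S i))) ->
  forall f, 0 <= dirichlet1 n a f.
Proof.
  intros HS f.
  replace (dirichlet1 n a f) with (dirichlet1 n a (fun i => f i + linf n f)).
  - apply (dirichlet1_nonneg_levels n a HS n (seq 0 n)).
    + now rewrite length_seq.
    + intros i Hi. pose proof (linf_ge n f i Hi).
      unfold Rabs in H. destruct (Rcase_abs (f i)); lra.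
    + intros i Hi _. apply in_seq. lia.
  - unfold dirichlet1. apply rsum_ext; intros i _. apply rsum_ext; intros j _.
    do 2 f_equal. ring.
Qed.

(** For equal signs the right side contains the factor [|a + b| >= |a - b|]; for opposite signs it
    is [2 * (a^2 + b^2)], which accounts for the 2. *)
Lemma sqr_sub_le_signed_sqr a b : (a - b) * (a - b) <= 2 * Rabs (a * Rabs a - b * Rabs b).
Proof.
  assert (H : forall a b, b <= a -> (a - b) * (a - b) <= 2 * Rabs (a * Rabs a - b * Rabs b)).
  { clear. intros a b Hab. pose proof (Rle_abs (a * Rabs a - b * Rabs b)).
    assert ((a - b) * (a - b) <= 2 * (a * Rabs a - b * Rabs b)); [|lra].
    unfold Rabs; destruct (Rcase_abs a), (Rcase_abs b); try lra.
    - nra.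
    - pose proof (Rle_0_sqr (a + b)). unfold Rsqr in *. lra.
    - nra. }
  destruct (Rle_lt_dec b a) as [h|h]; [now apply H|].
  specialize (H b a ltac:(lra)). rewrite (Rabs_minus_sym (a * Rabs a)). nra.
Qed.

Lemma signed_sqr_sub_le a b : Rabs (a * Rabs a - b * Rabs b) <= Rabs (a - b) * (Rabs a + Rabs b).
Proof.
  assert (H : forall a b, b <= a -> Rabs (a * Rabs a - b * Rabs b) <= Rabs (a - b) * (Rabs a + Rabs b)).
  { clear. intros a b Hab. rewrite (Rabs_right (a - b)) by lra. apply Rabs_le.
    unfold Rabs; destruct (Rcase_abs a), (Rcase_abs b); split; nra. }
  destruct (Rle_lt_dec b a) as [h|h]; [now apply H|].
  specialize (H b a ltac:(lra)). rewrite (Rabs_minus_sym (a * Rabs a)), (Rabs_minus_sym a). lra.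
Qed.

(* Cheeger's argument applied to z|z|; since z has mean zero no median is needed. *)
Lemma cheeger n (E : nat -> nat -> R) D p :
  0 < D -> D = INR n * p ->
  (forall i j, E i j = E j i) -> (forall i j, 0 <= E i j) ->
  (forall i, (i < n)%nat -> rsum n (E i) <= 3 * D) ->
  (forall S : nat -> bool, 0 <= dirichlet1 n (fun i j => E i j - p / 4) (fun i => b2R (S i))) ->
  forall z, rsum n z = 0 ->
  D / 192 * rsum n (fun i => z i * z i)
    <= rsum n (fun i => rsum n (fun j => E i j * ((z i - z j) * (z i - z j)))).
Proof.
  intros HD ED Hsym Hpos Hdeg Hcut z Hz.
  set (N2 := rsum n (fun i => z i * z i)).
  set (G := rsum n _).
  assert (Hp : 0 <= p).
  { destruct (Rle_lt_dec 0 p); [easy|]. pose proof (pos_INR n). nra. }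
  pose proof (coarea n _ Hcut (fun i => z i * Rabs (z i))) as Hco.
  (* The comparison graph is complete with weight [p / 4]; since [z] sums to zero, its squared
     differences add up to exactly [2 * n * N2]. *)
  assert (Hlow : p / 4 * (INR n * N2) <=
    rsum n (fun i => rsum n (fun j => p / 4 * Rabs (z i * Rabs (z i) - z j * Rabs (z j))))).
  { apply Rle_trans with (rsum n (fun i => rsum n (fun j => p / 8 * ((z i - z j) * (z i - z j))))).
    - right. symmetry.
      rewrite (rsum_ext n _ (fun i => p / 8 * (INR n * (z i * z i) + N2))).
      + rewrite rsum_scal, rsum_plus, rsum_scal, rsum_const. fold N2. field.
      + intros i _. rewrite rsum_scal. f_equal.
        rewrite (rsum_ext n _ (fun j => (z i * z i + z j * z j) - 2 * z i * z j)) by (intros; ring).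
        rewrite rsum_minus, rsum_plus, (rsum_scal n (2 * z i) z), rsum_const, Hz. fold N2. ring.
    - apply rsum_le. intros i _. apply rsum_le. intros j _.
      replace (p / 4 * _) with (p / 8 * (2 * Rabs (z i * Rabs (z i) - z j * Rabs (z j)))) by field.
      apply Rmult_le_compat_l; [lra|]. apply sqr_sub_le_signed_sqr. }
  (* AM-GM with weight 24 makes the degree term [D / 8 * N2], half of the lower bound [D / 4 * N2].
     The other half, divided by 24, is the [D / 192] of the conclusion. *)
  assert (Hup : rsum n (fun i => rsum n (fun j => E i j * Rabs (z i * Rabs (z i) - z j * Rabs (z j))))
                <= 24 * G + 2 / 48 * (3 * D * N2)).
  { apply Rle_trans with (24 * G + (/ 48 * rsum n (fun i => rsum n (fun j => E i j * (z i * z i)))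
       + / 48 * rsum n (fun i => rsum n (fun j => E i j * (z j * z j))))).
    - unfold G. rewrite <- !rsum_scal, <- !rsum_plus. apply rsum_le. intros i _.
      rewrite <- !rsum_scal, <- !rsum_plus. apply rsum_le. intros j _.
      assert (Rabs (z i * Rabs (z i) - z j * Rabs (z j)) <=
        24 * ((z i - z j) * (z i - z j)) + / 48 * (z i * z i) + / 48 * (z j * z j)).
      { assert (H : Rabs (z i * Rabs (z i) - z j * Rabs (z j)) <= Rabs (z i - z j) * (Rabs (z i) + Rabs (z j))).
        { apply signed_sqr_sub_le. }
        assert (H1 : Rabs (z i - z j) * Rabs (z i - z j) = (z i - z j) * (z i - z j))
          by (unfold Rabs; destruct Rcase_abs; ring).
        assert (H2 : Rabs (z i) * Rabs (z i) = z i * z i) by (unfold Rabs; destruct Rcase_abs; ring).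
        assert (H3 : Rabs (z j) * Rabs (z j) = z j * z j) by (unfold Rabs; destruct Rcase_abs; ring).
        rewrite <- H1, <- H2, <- H3.
        pose proof (Rle_0_sqr (Rabs (z i - z j) - / 48 * (Rabs (z i) + Rabs (z j)))) as S1.
        pose proof (Rle_0_sqr (Rabs (z i) - Rabs (z j))) as S2.
        unfold Rsqr in *. lra. }
      apply (Rmult_le_compat_l _ _ _ (Hpos i j)) in H. lra.
    - rewrite (rsum_swap n n (fun i j => E i j * (z j * z j))).
      rewrite (rsum_ext n (fun j => rsum n (fun i => E i j * (z j * z j)))
                 (fun i => rsum n (fun j => E i j * (z i * z i)))).
      2: { intros i _. apply rsum_ext. intros j _. now rewrite (Hsym j i). }
      assert (rsum n (fun i => rsum n (fun j => E i j * (z i * z i))) <= 3 * D * N2); [|lra].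
      unfold N2. rewrite <- rsum_scal. apply rsum_le. intros i Hi.
      rewrite (rsum_ext n _ (fun j => (z i * z i) * E i j)) by (intros; ring).
      rewrite rsum_scal. specialize (Hdeg i Hi). pose proof (Rle_0_sqr (z i)). unfold Rsqr in *. nra. }
  assert (Hco' : 0 <= rsum n (fun i => rsum n (fun j => E i j * Rabs (z i * Rabs (z i) - z j * Rabs (z j))))
      - rsum n (fun i => rsum n (fun j => p / 4 * Rabs (z i * Rabs (z i) - z j * Rabs (z j))))).
  { rewrite <- rsum_minus. unfold dirichlet1 in Hco. erewrite rsum_ext; [exact Hco|].
    intros i _. simpl. rewrite <- rsum_minus. apply rsum_ext. intros j _. ring. }
  assert (p / 4 * (INR n * N2) = D / 4 * N2) as E1 by (rewrite ED; field).
  lra.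
Qed.

(** * The balance operator *)

Definition lap (n : nat) (w : nat -> R) (f : nat -> nat -> R) (x : nat -> R) (m : nat) : R :=
  rsum n (fun i => w m * x m * f m i - w i * x i * f i m).

Definition drop_vertex (m : nat) (f : nat -> nat -> R) (i j : nat) : R :=
  if (Nat.eqb i m || Nat.eqb j m)%bool then 0 else f i j.

Lemma lap_sum n w f x : rsum n (lap n w f x) = 0.
Proof.
  unfold lap. rewrite (rsum_ext n _ (fun m => rsum n (fun i => w m * x m * f m i)
     - rsum n (fun i => w i * x i * f i m))) by (intros; apply rsum_minus).
  rewrite rsum_minus, (rsum_swap n n (fun m i => w i * x i * f i m)). lra.
Qed.

Lemma lap_lin n w f a b x y z m : (m < n)%nat -> (forall i, (i < n)%nat -> z i = a * x i + b * y i) ->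
  lap n w f z m = a * lap n w f x m + b * lap n w f y m.
Proof.
  intros Hm H. unfold lap. rewrite <- !rsum_scal, <- rsum_plus. apply rsum_ext. intros i Hi.
  rewrite !H by easy. ring.
Qed.

(* The antisymmetric part of the form acts diagonally, so no spectral bound on the noise is needed. *)
Lemma lap_quad n w f z :
  rsum n (fun m => z m * lap n w f z m) =
  / 2 * rsum n (fun m => rsum n (fun i => w m * f m i * ((z m - z i) * (z m - z i)))) +
  / 2 * rsum n (fun m => z m * z m * lap n w f (fun _ => 1) m).
Proof.
  set (a := rsum n (fun m => rsum n (fun i => w m * f m i * (z m * z m)))).
  set (b := rsum n (fun m => rsum n (fun i => w m * f m i * (z m * z i)))).
  set (c := rsum n (fun m => rsum n (fun i => w m * f m i * (z i * z i)))).
  assert (E1 : rsum n (fun m => z m * lap n w f z m) = a - b).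
  { unfold lap, a, b. rewrite (rsum_swap n n (fun m i => w m * f m i * (z m * z i))).
    rewrite <- rsum_minus. apply rsum_ext. intros m _.
    rewrite <- rsum_scal, <- rsum_minus. apply rsum_ext. intros i _. ring. }
  assert (E2 : rsum n (fun m => z m * z m * lap n w f (fun _ => 1) m) = a - c).
  { unfold lap, a, c. rewrite (rsum_swap n n (fun m i => w m * f m i * (z i * z i))).
    rewrite <- rsum_minus. apply rsum_ext. intros m _.
    rewrite <- rsum_scal, <- rsum_minus. apply rsum_ext. intros i _. ring. }
  assert (E3 : rsum n (fun m => rsum n (fun i => w m * f m i * ((z m - z i) * (z m - z i))))
      = a - 2 * b + c).
  { unfold a, b, c. rewrite <- rsum_scal, <- rsum_minus, <- rsum_plus. apply rsum_ext. intros m _.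
    rewrite <- rsum_scal, <- rsum_minus, <- rsum_plus. apply rsum_ext. intros i _. ring. }
  rewrite E1, E2, E3. field.
Qed.

Lemma lap_drop_vertex n w f x m k : (m < n)%nat -> k <> m ->
  lap n w f x k = lap n w (drop_vertex m f) x k + (w k * x k * f k m - w m * x m * f m k).
Proof.
  intros Hm Hk. unfold lap. rewrite (rsum_split n m _ Hm).
  rewrite (rsum_split n m (fun i => w k * x k * drop_vertex m f k i - _) Hm).
  unfold drop_vertex. rewrite Nat.eqb_refl, Bool.orb_true_r. simpl.
  destruct (Nat.eqb_spec k m) as [|_]; [easy|]. simpl.
  rewrite (rsum_ext n _ (fun i => if Nat.eqb i m then 0 else
     w k * x k * (if Nat.eqb i m then 0 else f k i) -
     w i * x i * (if (Nat.eqb i m || false)%bool then 0 else f i k))); [ring|].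
  intros i _. destruct (Nat.eqb i m); reflexivity.
Qed.

Lemma lap_drop_vertex_self n w f x m : lap n w (drop_vertex m f) x m = 0.
Proof.
  unfold lap. rewrite <- (rsum_0 n). apply rsum_ext. intros i _.
  unfold drop_vertex. rewrite Nat.eqb_refl, Bool.orb_true_r. simpl. ring.
Qed.

(* M is the single large constant; c0 = 100 M^2 makes D >= c0 ln n imply every size condition below. *)
Record good_data (n : nat) (K M D tau : R) (w : nat -> R) (f : nat -> nat -> R) : Prop := {
  gd_K : 1 <= K;
  gd_M : M = 10000000000 * (K * K * K * K);
  gd_tau : 0 <= tau;
  gd_tauM : 10 * M * tau <= 1;
  gd_n : M <= sqrt (INR n);
  gd_D : M <= D;
  gd_w : forall i, (i < n)%nat -> 1 <= w i <= K;
  gd_f : forall i j, 0 <= f i j;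
  gd_f1 : forall i j, f i j + f j i <= 1;
  gd_deg : forall m, (m < n)%nat -> D / 8 <= rsum n (fun j => f m j + f j m) <= 3 * D;
  gd_gap : forall z, rsum n z = 0 -> D / 192 * rsum n (fun i => z i * z i)
    <= rsum n (fun i => rsum n (fun j => (f i j + f j i) * ((z i - z j) * (z i - z j))));
  gd_row : forall m, (m < n)%nat -> Rabs (lap n w f (fun _ => 1) m) <= 30 * (K * K) * D * tau;
  gd_pair : forall m, (m < n)%nat ->
    norm2 n (fun k => w k * f k m - w m * f m k) <= 32 * K * D * tau }.

Lemma good_K4 n K M D tau w f : good_data n K M D tau w f ->
  1 <= K /\ K <= K * K /\ K * K <= K * K * K /\ K * K * K <= K * K * K * K.
Proof. intros []. repeat split; nra. Qed.

(** The gap together with [w >= 1] gives [D / 768], since each unordered pair occurs twice;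
    [10 * M * tau <= 1] confines the diagonal noise to half of that. *)
Lemma coercive n K M D tau w f : good_data n K M D tau w f -> forall z, rsum n z = 0 ->
  D / 1536 * rsum n (fun i => z i * z i) <= rsum n (fun m => z m * lap n w f z m).
Proof.
  intros g z Hz. pose proof (good_K4 _ _ _ _ _ _ _ g) as HK. destruct g.
  rewrite lap_quad. specialize (gd_gap0 z Hz).
  set (N2 := rsum n (fun i => z i * z i)) in *.
  assert (HN : 0 <= N2) by apply sumsq_nonneg.
  assert (H1 : D / 192 * N2 <= 2 * rsum n (fun m => rsum n (fun i => w m * f m i * ((z m - z i) * (z m - z i))))).
  { eapply Rle_trans; [apply gd_gap0|].
    rewrite (rsum_ext n _ (fun i => rsum n (fun j => f i j * ((z i - z j) * (z i - z j)))
       + rsum n (fun j => f j i * ((z i - z j) * (z i - z j))))).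
    2: { intros i _. rewrite <- rsum_plus. apply rsum_ext. intros; ring. }
    rewrite rsum_plus, (rsum_swap n n (fun i j => f j i * ((z i - z j) * (z i - z j)))).
    rewrite <- rsum_plus, <- rsum_scal. apply rsum_le. intros i Hi.
    rewrite <- rsum_plus, <- rsum_scal. apply rsum_le. intros j _.
    destruct (gd_w0 i Hi) as [Hw _]. specialize (gd_f0 i j).
    pose proof (Rle_0_sqr (z i - z j)) as Hs. unfold Rsqr in Hs.
    assert (0 <= (w i - 1) * (f i j * ((z i - z j) * (z i - z j)))); [|nra].
    apply Rmult_le_pos; [lra|]. now apply Rmult_le_pos. }
  assert (H2 : - (30 * (K * K) * D * tau) * N2 <= rsum n (fun m => z m * z m * lap n w f (fun _ => 1) m)).
  { unfold N2. rewrite <- rsum_scal. apply rsum_le. intros m Hm. specialize (gd_row0 m Hm).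
    pose proof (Rle_abs (- lap n w f (fun _ => 1) m)) as Ha. rewrite Rabs_Ropp in Ha. pose proof (Rle_0_sqr (z m)) as Hs. unfold Rsqr in Hs. nra. }
  assert (0 < D) by nra.
  assert (30 * (K * K) * tau <= / 768).
  { assert (K * K * tau <= K * K * K * K * tau) by nra. nra. }
  assert (0 <= D * N2) by nra.
  assert (30 * (K * K) * D * tau * N2 <= / 768 * (D * N2)); [|lra].
  replace (30 * (K * K) * D * tau * N2) with (30 * (K * K) * tau * (D * N2)) by ring.
  now apply Rmult_le_compat_r.
Qed.

Lemma coercive_norm n K M D tau w f : good_data n K M D tau w f -> forall z b, rsum n z = 0 ->
  0 <= b -> rsum n (fun m => z m * lap n w f z m) <= norm2 n z * (D * b) -> norm2 n z <= 1536 * b.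
Proof.
  intros g z b Hz Hb H. pose proof (coercive _ _ _ _ _ _ _ g z Hz) as Hc.
  pose proof (good_K4 _ _ _ _ _ _ _ g) as HK.
  assert (0 < D) by (destruct g; nra).
  rewrite <- norm2_sqr in Hc. pose proof (norm2_nonneg n z) as HN.
  destruct (Req_dec (norm2 n z) 0) as [->|E]; [lra|].
  apply Rmult_le_reg_l with (norm2 n z * D / 1536); [|lra].
  apply Rmult_lt_0_compat; [apply Rmult_lt_0_compat|]; lra.
Qed.

(** Without its edges, [m] is isolated and its equation is void, so its entry is pinned by
    [eta m = 0]. The zero sum is what lets coercivity act on [x - 1 - eta]. *)
Definition loo_solution (n : nat) (w : nat -> R) (f : nat -> nat -> R) (m : nat) (eta : nat -> R) : Prop :=
  eta m = 0 /\ rsum n eta = 0 /\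
  forall k, (k < n)%nat -> k <> m -> lap n w (drop_vertex m f) (fun i => 1 + eta i) k = 0.

Lemma lap_as_row n w f x k : (k < n)%nat ->
  lap n w f x k = rsum n (fun j => ((if Nat.eqb j k then w k * rsum n (f k) else 0) - w j * f j k) * x j).
Proof.
  intros Hk. unfold lap.
  transitivity (rsum n (fun j => (if Nat.eqb j k then w k * rsum n (f k) * x k else 0) - w j * x j * f j k)).
  - rewrite !rsum_minus. f_equal. rewrite rsum_scal.
    rewrite (rsum_split n k (fun j => if Nat.eqb j k then w k * rsum n (f k) * x k else 0) Hk), Nat.eqb_refl.
    rewrite (rsum_ext n (fun i => if Nat.eqb i k then 0 else _) (fun _ => 0)), rsum_0.
    + change (rsum n (fun i => f k i)) with (rsum n (f k)). ring.
    + intros i _. now destruct (Nat.eqb i k).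
  - apply rsum_ext. intros j _. destruct (Nat.eqb_spec j k) as [->|]; ring.
Qed.

(** A dimension count gives a nonzero solution of the reduced equations, and coercivity of the full
    system shows that its sum can be normalized. *)
Lemma loo_solution_exists n K M D tau w f m : good_data n K M D tau w f -> (m < n)%nat ->
  exists eta, loo_solution n w f m eta.
Proof.
  intros g Hm. pose proof (good_K4 _ _ _ _ _ _ _ g) as HK.
  assert (Hn : (2 <= n)%nat).
  { destruct (le_lt_dec 2 n) as [|Hlt]; [easy|]. destruct g.
    assert (INR n <= 1) by (replace 1 with (INR 1) by reflexivity; apply le_INR; lia).
    assert (sqrt (INR n) <= 1) by (rewrite <- sqrt_1; now apply sqrt_le_1_alt). nra. }
  set (V := filter (fun i => negb (Nat.eqb i m)) (seq 0 n)).
  assert (HV : forall i, In i V <-> (i < n)%nat /\ i <> m).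
  { intros i. unfold V. rewrite filter_In, in_seq, Bool.negb_true_iff, Nat.eqb_neq. lia. }
  (* The equation at [k0] is left out, so that there are fewer equations than unknowns; it is
     recovered from [lap_sum]. *)
  set (k0 := if Nat.eqb m 0 then 1%nat else 0%nat).
  assert (Hk0 : (k0 < n)%nat /\ k0 <> m) by (unfold k0; destruct (Nat.eqb_spec m 0); lia).
  set (f' := drop_vertex m f).
  set (row := fun k j => (if Nat.eqb j k then w k * rsum n (f' k) else 0) - w j * f' j k).
  destruct (homogeneous_system n _ (map row (remove Nat.eq_dec k0 V)) V eq_refl)
    as [u [[j1 [Hj1 Hu1]] [Hsupp Hu]]].
  - apply NoDup_filter, seq_NoDup.
  - intros i Hi. now apply HV in Hi.
  - rewrite length_map. apply remove_length_lt. now apply HV.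
  - assert (Hum : u m = 0) by (apply Hsupp; rewrite HV; lia).
    assert (H0 : forall k, (k < n)%nat -> k <> k0 -> lap n w f' u k = 0).
    { intros k Hk Hkk. destruct (Nat.eq_dec k m) as [->|Hkm]; [apply lap_drop_vertex_self|].
      rewrite lap_as_row by easy. apply (Hu (row k)), in_map, in_in_remove; [easy|]. now apply HV. }
    assert (Hall : forall k, (k < n)%nat -> lap n w f' u k = 0).
    { intros k Hk. destruct (Nat.eq_dec k k0) as [->|]; [|now apply H0].
      pose proof (lap_sum n w f' u) as HS. rewrite (rsum_split n k0) in HS by easy.
      rewrite (rsum_ext n _ (fun _ => 0)), rsum_0 in HS; [lra|].
      intros i Hi. destruct (Nat.eqb_spec i k0); [easy|now apply H0]. }
    (* On a solution with zero sum, the full [lap] differs from the reduced one only through the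
       edge to [m], of weight at most [K]. Coercivity would then force [D / 1536 <= K]. *)
    assert (HS : rsum n u <> 0).
    { intros HS. pose proof (coercive _ _ _ _ _ _ _ g u HS) as Hc. destruct g.
      assert (Hub : rsum n (fun k => u k * lap n w f u k) <= K * rsum n (fun i => u i * u i)).
      { rewrite <- rsum_scal. apply rsum_le. intros k Hk.
        destruct (Nat.eq_dec k m) as [->|Hkm]; [rewrite Hum; lra|].
        rewrite (lap_drop_vertex n w f u m k Hm Hkm). fold f'. rewrite Hall by easy. rewrite Hum.
        destruct (gd_w0 k Hk). pose proof (gd_f0 k m). pose proof (gd_f0 m k). pose proof (gd_f2 k m).
        pose proof (Rle_0_sqr (u k)) as Hs. unfold Rsqr in Hs.
        assert (w k * f k m <= K) by nra. nra. }
      assert (Hp : 0 < rsum n (fun i => u i * u i)).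
      { apply Rlt_le_trans with (u j1 * u j1); [nra|].
        apply (rsum_term_le n (fun i => u i * u i)); [now apply HV in Hj1|intros; nra]. }
      assert (K < D / 1536) by nra. nra. }
    (* The entries off [m] have to sum to [n - 1]: with the value 1 at [m] the total is [n]. *)
    set (c := INR (n - 1) / rsum n u).
    exists (fun k => if Nat.eqb k m then 0 else c * u k - 1). split; [|split].
    + now rewrite Nat.eqb_refl.
    + rewrite (rsum_ext n _ (fun k => c * u k - (if Nat.eqb k m then 0 else 1))).
      2: { intros k _. destruct (Nat.eqb_spec k m) as [->|]; [rewrite Hum|]; ring. }
      rewrite rsum_minus, rsum_scal.
      assert (E : rsum n (fun i => if Nat.eqb i m then 0 else 1) = INR (n - 1)).
      { pose proof (rsum_split n m (fun _ => 1) Hm) as E. rewrite rsum_const in E.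
        rewrite minus_INR by lia. simpl (INR 1). lra. }
      rewrite E. unfold c. field. easy.
    + intros k Hk Hkm. fold f'.
      transitivity (lap n w f' (fun i => c * u i) k).
      * apply rsum_ext. intros i _. unfold f', drop_vertex.
        destruct (Nat.eqb_spec k m); [easy|]. destruct (Nat.eqb_spec i m) as [->|]; simpl; ring.
      * rewrite (lap_lin n w f' c 0 u u _ k Hk) by (intros; ring). rewrite Hall by easy. ring.
Qed.

(** * Leave-one-out analysis *)

Lemma rsum_mult_le_norm2 n u v : rsum n (fun i => u i * v i) <= norm2 n u * norm2 n v.
Proof.
  eapply Rle_trans; [|apply cauchy_schwarz]. apply rsum_le. intros i _.
  rewrite <- Rabs_mult. apply Rle_abs.
Qed.

(** Since [lap x = 0], the error solves [lap (x - 1) = - lap 1], whose right side is pure noise of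
    size [gd_row] in each of the [n] entries. *)
Lemma l2_error n K M D tau w f x : good_data n K M D tau w f ->
  (forall m, (m < n)%nat -> lap n w f x m = 0) -> rsum n x = INR n ->
  norm2 n (fun i => x i - 1) <= 1536 * (30 * (K * K) * tau * sqrt (INR n)).
Proof.
  intros g Hx Hsum. pose proof (good_K4 _ _ _ _ _ _ _ g) as HK.
  set (d := fun i => x i - 1).
  assert (HD : 0 < D) by (destruct g; nra).
  assert (Hr : norm2 n (fun m => - lap n w f (fun _ => 1) m) <= 30 * (K * K) * D * tau * sqrt (INR n)).
  { destruct g. pose proof (sqrt_pos (INR n)).
    assert (H0 : 0 <= 30 * (K * K) * D * tau) by (repeat apply Rmult_le_pos; lra).
    apply norm2_le; [now apply Rmult_le_pos|].
    replace (30 * (K * K) * D * tau * sqrt (INR n) * (30 * (K * K) * D * tau * sqrt (INR n)))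
      with (INR n * ((30 * (K * K) * D * tau) * (30 * (K * K) * D * tau))).
    2: { rewrite <- (sqrt_sqrt (INR n)) at 1 by apply pos_INR. ring. }
    rewrite <- rsum_const. apply rsum_le. intros m Hm. specialize (gd_row0 m Hm).
    set (a := lap n w f _ m) in *. replace (- a * - a) with (Rabs a * Rabs a)
      by (unfold Rabs; destruct (Rcase_abs a); ring).
    pose proof (Rabs_pos a). apply Rmult_le_compat; lra. }
  apply (coercive_norm _ _ _ _ _ _ _ g d).
  - unfold d. rewrite rsum_minus, rsum_const. change (rsum n (fun i => x i)) with (rsum n x). lra.
  - destruct g. pose proof (sqrt_pos (INR n)). repeat apply Rmult_le_pos; lra.
  - rewrite (rsum_ext n _ (fun m => d m * - lap n w f (fun _ => 1) m)).
    2: { intros m Hm. rewrite (lap_lin n w f 1 (-1) x (fun _ => 1) d m Hm) by (intros; unfold d; ring).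
         rewrite Hx by easy. ring. }
    eapply Rle_trans; [apply rsum_mult_le_norm2|].
    replace (norm2 n d * (D * _)) with (norm2 n d * (30 * (K * K) * D * tau * sqrt (INR n))) by ring.
    apply Rmult_le_compat_l; [apply norm2_nonneg|easy].
Qed.

(** The vector [x - 1 - eta] has the residual [- lap (1 + eta)], which comes from the edges at [m]
    only: its noise gives the 62 (30 from the row of [m], 32 from the neighbours), and the values of
    [eta] at the neighbours enter once from each side, hence the factor 2. *)
Lemma loo_distance n K M D tau w f x m eta : good_data n K M D tau w f ->
  (forall k, (k < n)%nat -> lap n w f x k = 0) -> rsum n x = INR n -> (m < n)%nat ->
  loo_solution n w f m eta ->
  norm2 n (fun i => x i - 1 - eta i) <=
    1536 * (2 * K * (rsum n (fun k => (f m k + f k m) * Rabs (eta k)) / D) + 62 * (K * K) * tau).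
Proof.
  intros g Hx Hsum Hm [Hem [Hes Hel]]. pose proof (good_K4 _ _ _ _ _ _ _ g) as HK.
  assert (HD : 0 < D) by (destruct g; nra).
  set (z := fun i => x i - 1 - eta i).
  set (T := rsum n (fun k => (f m k + f k m) * Rabs (eta k))).
  assert (HT : 0 <= T).
  { apply rsum_nonneg. intros k _. destruct g. pose proof (gd_f0 m k). pose proof (gd_f0 k m).
    apply Rmult_le_pos; [lra|apply Rabs_pos]. }
  pose proof (norm2_nonneg n z) as HN.
  apply (coercive_norm _ _ _ _ _ _ _ g z).
  - unfold z. rewrite !rsum_minus, rsum_const. change (rsum n (fun i => x i)) with (rsum n x).
    change (rsum n (fun i => eta i)) with (rsum n eta). lra.
  - destruct g. assert (0 <= T / D) by (apply Rmult_le_pos; [easy|left; now apply Rinv_0_lt_compat]).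
    apply Rplus_le_le_0_compat; [apply Rmult_le_pos; [lra|easy]|repeat apply Rmult_le_pos; lra].
  - assert (Hz : forall k, (k < n)%nat -> lap n w f z k = - lap n w f (fun i => 1 + eta i) k).
    { intros k Hk. rewrite (lap_lin n w f 1 (-1) x (fun i => 1 + eta i) z k Hk) by (intros; unfold z; ring).
      rewrite Hx by easy. ring. }
    destruct g.
    assert (Hmm : z m * lap n w f z m <= norm2 n z * (30 * (K * K) * D * tau + K * T)).
    { rewrite Hz by easy.
      assert (Hs : Rabs (- lap n w f (fun i => 1 + eta i) m) <= 30 * (K * K) * D * tau + K * T).
      { assert (E : lap n w f (fun i => 1 + eta i) m
           = lap n w f (fun _ => 1) m - rsum n (fun i => w i * eta i * f i m)).
        { unfold lap. rewrite <- rsum_minus. apply rsum_ext. intros i _. rewrite Hem. ring. }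
        rewrite Rabs_Ropp, E. unfold Rminus at 1.
        eapply Rle_trans; [apply Rabs_triang|]. rewrite Rabs_Ropp.
        apply Rplus_le_compat; [now apply gd_row0|].
        eapply Rle_trans; [apply rsum_abs|]. unfold T. rewrite <- rsum_scal. apply rsum_le.
        intros i Hi. pose proof (gd_f0 m i). pose proof (gd_f0 i m). destruct (gd_w0 i Hi).
        rewrite !Rabs_mult, (Rabs_right (w i)), (Rabs_right (f i m)) by lra.
        pose proof (Rabs_pos (eta i)).
        apply Rle_trans with (K * Rabs (eta i) * f i m);
          [repeat apply Rmult_le_compat_r; lra|].
        assert (0 <= K * (f m i * Rabs (eta i))); [|lra].
        apply Rmult_le_pos; [lra|now apply Rmult_le_pos]. }
      eapply Rle_trans; [apply Rle_abs|]. rewrite Rabs_mult.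
      apply Rmult_le_compat; try apply Rabs_pos; [now apply abs_le_norm2|easy]. }
    (* Off [m] the reduced equation removes everything but the edge to [m]. Its noise is bounded as
       a vector over the neighbours by [gd_pair]; entrywise bounds against the sup of [z] would be
       too large. *)
    assert (Hoff : rsum n (fun k => if Nat.eqb k m then 0 else z k * lap n w f z k)
                   <= norm2 n z * (32 * K * D * tau + K * T)).
    { apply Rle_trans with (rsum n (fun k => Rabs (z k) * Rabs (w k * f k m - w m * f m k))
          + norm2 n z * K * T).
      - unfold T. rewrite <- rsum_scal, <- rsum_plus. apply rsum_le. intros k Hk.
        pose proof (gd_f0 m k). pose proof (gd_f0 k m). destruct (gd_w0 k Hk).
        pose proof (Rabs_pos (eta k)). pose proof (abs_le_norm2 n z k Hk). pose proof (Rabs_pos (z k)).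
        assert (Hb : Rabs (z k) * (w k * Rabs (eta k) * f k m) <=
                norm2 n z * K * ((f m k + f k m) * Rabs (eta k))).
        { apply Rle_trans with (norm2 n z * (K * ((f m k + f k m) * Rabs (eta k)))); [|lra].
          apply Rmult_le_compat; [easy| |easy|].
          - repeat apply Rmult_le_pos; lra.
          - rewrite Rmult_assoc. apply Rmult_le_compat; [lra| |lra|].
            + apply Rmult_le_pos; lra.
            + rewrite Rmult_comm. apply Rmult_le_compat_r; lra. }
        assert (0 <= Rabs (z k) * (w k * Rabs (eta k) * f k m))
          by (repeat apply Rmult_le_pos; lra).
        assert (0 <= Rabs (z k) * Rabs (w k * f k m - w m * f m k))
          by (apply Rmult_le_pos; apply Rabs_pos).
        destruct (Nat.eqb_spec k m) as [_|Hkm]; [lra|].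
        rewrite Hz by easy.
        rewrite (lap_drop_vertex n w f _ m k Hm Hkm), Hel, Hem by easy.
        eapply Rle_trans; [apply Rle_abs|]. rewrite Rabs_mult.
        replace (- (0 + (w k * (1 + eta k) * f k m - w m * (1 + 0) * f m k)))
          with (- ((w k * f k m - w m * f m k) + w k * eta k * f k m)) by ring.
        rewrite Rabs_Ropp.
        assert (Rabs ((w k * f k m - w m * f m k) + w k * eta k * f k m) <=
          Rabs (w k * f k m - w m * f m k) + w k * Rabs (eta k) * f k m).
        { eapply Rle_trans; [apply Rabs_triang|].
          rewrite !(Rabs_mult _ (f k m)), (Rabs_mult (w k) (eta k)), (Rabs_right (w k)), (Rabs_right (f k m)) by lra. lra. }
        apply Rle_trans with (Rabs (z k) * (Rabs (w k * f k m - w m * f m k) + w k * Rabs (eta k) * f k m)); [|lra].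
        now apply Rmult_le_compat_l.
      - pose proof (cauchy_schwarz n z (fun k => w k * f k m - w m * f m k)) as CS.
        specialize (gd_pair0 m Hm). simpl in CS.
        apply (Rmult_le_compat_l (norm2 n z)) in gd_pair0; [|easy]. lra. }
    rewrite (rsum_split n m _ Hm).
    replace (norm2 n z * (D * (2 * K * (T / D) + 62 * (K * K) * tau)))
      with (norm2 n z * (2 * K * T + 62 * (K * K) * D * tau)) by (field; lra).
    apply Rle_trans with (norm2 n z * (30 * (K * K) * D * tau + K * T + (32 * K * D * tau + K * T))); [lra|].
    apply Rmult_le_compat_l; [easy|].
    assert (0 <= (K * K - K) * (D * tau)) by (repeat apply Rmult_le_pos; lra). lra.
Qed.

(** Each entry satisfies [|d m| <= M * tau + X / 2] with [X] the sup norm itself, and a maximum over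
    [m] closes the loop. *)
Lemma linf_error n K M D tau w f x ell p (eta : nat -> nat -> R) : good_data n K M D tau w f ->
  D = INR n * p -> 0 <= ell -> M * ell <= D ->
  (forall k, (k < n)%nat -> lap n w f x k = 0) -> rsum n x = INR n ->
  (forall m, (m < n)%nat -> loo_solution n w f m (eta m)) ->
  (forall m, (m < n)%nat -> rsum n (fun k => (f m k + f k m) * Rabs (eta m k))
     <= 2 * p * rsum n (fun k => Rabs (eta m k)) + 6 * ell * linf n (eta m)) ->
  forall m, (m < n)%nat -> Rabs (x m - 1) <= 2 * M * tau.
Proof.
  intros g HDp Hell HMl Hx Hsum Hloo Hch. pose proof (good_K4 _ _ _ _ _ _ _ g) as HK.
  set (d := fun i => x i - 1). set (X := linf n d).
  pose proof (linf_nonneg n d) as HX. fold X in HX.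
  pose proof (l2_error _ _ _ _ _ _ _ x g Hx Hsum) as Hl2. fold d in Hl2.
  set (nu := sqrt (INR n)) in *.
  assert (Hnu : nu * nu = INR n) by apply sqrt_sqrt, pos_INR.
  assert (HM : 10000000000 * K <= M) by (destruct g; nra).
  assert (HM2 : 10000000000 * (K * K) <= M) by (destruct g; nra).
  assert (HD : 0 < D) by (destruct g; nra).
  assert (HnuM : M <= nu) by (destruct g; easy).
  assert (Htau : 0 <= tau) by (destruct g; easy).
  (* Here 95232 is 1536 times the 62 of [loo_distance], and below 46080 is 1536 times the 30 of
     [l2_error]. *)
  set (B := 95232 * (K * K) * tau).
  assert (HB : 0 <= B) by (unfold B; repeat apply Rmult_le_pos; lra).
  assert (Hmain : forall m, (m < n)%nat -> Rabs (d m) <= M * tau + X / 2).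
  { intros m Hm.
    pose proof (loo_distance _ _ _ _ _ _ _ x m (eta m) g Hx Hsum Hm (Hloo m Hm)) as Hz.
    set (z := fun i => x i - 1 - eta m i) in *.
    specialize (Hch m Hm). set (T := rsum n (fun k => (f m k + f k m) * Rabs (eta m k))) in *.
    set (Q := T / D) in *. assert (HQ : T = D * Q) by (unfold Q; field; lra).
    set (Z := norm2 n z) in *. assert (HZ : 0 <= Z) by apply norm2_nonneg.
    assert (Hinf : linf n (eta m) <= X + Z).
    { apply linf_le; [lra|]. intros k Hk.
      replace (eta m k) with (d k + - z k) by (unfold d, z; ring).
      eapply Rle_trans; [apply Rabs_triang|]. rewrite Rabs_Ropp.
      apply Rplus_le_compat; [now apply linf_ge|now apply (abs_le_norm2 n z k)]. }
    assert (He2 : norm2 n (eta m) <= 46080 * (K * K) * tau * nu + Z).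
    { eapply Rle_trans; [apply (norm2_triangle n d (fun i => - z i)); intros; unfold d, z; ring|].
      replace (norm2 n (fun i => - z i)) with Z; [lra|].
      unfold Z, norm2. f_equal. apply rsum_ext. intros; ring. }
    assert (He1 : rsum n (fun k => Rabs (eta m k)) <= nu * (46080 * (K * K) * tau * nu + Z)).
    { eapply Rle_trans; [apply sum_abs_le_norm2|]. fold nu.
      apply Rmult_le_compat_l; [lra|easy]. }
    assert (Hp : 0 < p) by (rewrite HDp, <- Hnu in HD; nra).
    (* Both small factors come from [M]: [p * nu = D / nu <= D / M] and [ell <= D / M]. Only the l2
       error of [x], multiplied by [2 * p * nu * nu = 2 * D], appears without one. *)
    assert (HQb : Q <= 92160 * (K * K) * tau + 2 / M * Z + 6 / M * (X + Z)).
    { apply Rmult_le_reg_l with D; [easy|]. rewrite <- HQ.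
      eapply Rle_trans; [apply Hch|].
      apply Rle_trans with (2 * p * (nu * (46080 * (K * K) * tau * nu + Z)) + 6 * ell * (X + Z)).
      { apply Rplus_le_compat; apply Rmult_le_compat_l; lra. }
      replace (D * (92160 * (K * K) * tau + 2 / M * Z + 6 / M * (X + Z)))
        with (D * (92160 * (K * K) * tau) + 2 * (D / M) * Z + 6 * (D / M) * (X + Z)) by (field; lra).
      assert (E1 : ell <= D / M).
      { apply Rmult_le_reg_l with M; [lra|]. replace (M * (D / M)) with D by (field; lra). easy. }
      assert (E2 : p * nu <= D / M).
      { apply Rmult_le_reg_l with M; [lra|]. replace (M * (D / M)) with D by (field; lra).
        rewrite HDp, <- Hnu. assert (0 <= p * nu) by nra. nra. }
      replace (2 * p * (nu * (46080 * (K * K) * tau * nu + Z)))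
        with (D * (92160 * (K * K) * tau) + 2 * (p * nu) * Z) by (rewrite HDp, <- Hnu; ring).
      assert (p * nu * Z <= D / M * Z) by (apply Rmult_le_compat_r; lra).
      assert (ell * (X + Z) <= D / M * (X + Z)) by (apply Rmult_le_compat_r; lra). lra. }
    assert (HMi : / M <= / (10000000000 * (K * K))) by (apply Rinv_le_contravar; nra).
    assert (HQ0 : 0 <= Q).
    { unfold Q. apply Rmult_le_pos; [|left; now apply Rinv_0_lt_compat].
      apply rsum_nonneg. intros k _. destruct g. pose proof (gd_f0 m k). pose proof (gd_f0 k m).
      apply Rmult_le_pos; [lra|apply Rabs_pos]. }
    assert (HZb : Z <= 3072 * K * Q + B) by (unfold B; lra).
    assert (HKi : K * / (K * K) <= 1).
    { replace (K * / (K * K)) with (/ K) by (field; lra). rewrite <- Rinv_1. apply Rinv_le_contravar; lra. }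
    assert (HK2i : K * K * / (K * K) = 1) by (field; lra).
    assert (HK0 : 0 < / (K * K)) by (apply Rinv_0_lt_compat; nra).
    rewrite Rinv_mult in HMi.
    (* [Z] is in turn bounded by [Q]; the factor [/ M] beats the powers of [K] in that bound, so [Q]
       returns with a small coefficient and is absorbed in [HQc]. *)
    assert (HMZ : 8 / M * Z <= / 1000 * Q + / 1000 * tau).
    { apply Rle_trans with (8 * (/ 10000000000 * / (K * K)) * (3072 * K * Q + B)).
      - apply Rmult_le_compat; [|easy| |easy]; [|lra].
        apply Rmult_le_pos; [lra|]. left. apply Rinv_0_lt_compat. lra.
      - unfold B.
        replace (8 * (/ 10000000000 * / (K * K)) * (3072 * K * Q + 95232 * (K * K) * tau))
          with (8 * / 10000000000 * (3072 * (K * / (K * K) * Q) + 95232 * (K * K * / (K * K) * tau))) by ring.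
        rewrite HK2i. assert (K * / (K * K) * Q <= 1 * Q) by (apply Rmult_le_compat_r; lra). lra. }
    assert (HQc : Q <= 100000 * (K * K) * tau + 7 / M * X).
    { assert (tau <= K * K * tau) by nra.
      assert (0 <= / M * X) by (apply Rmult_le_pos; [left; apply Rinv_0_lt_compat; lra|easy]). lra. }
    (* The coefficient of [d m] in the balance equation. Outflow [a] and inflow [b] have a sum of at
       least [D / 8] and differ by noise of at most [D / 16], hence [a >= D / 32]. *)
    set (a := w m * rsum n (fun i => f m i)).
    assert (Ha : D / 32 <= a).
    { destruct g. specialize (gd_row0 m Hm). destruct (gd_deg0 m Hm) as [Hdg _].
      set (b := rsum n (fun i => w i * f i m)).
      assert (Eab : lap n w f (fun _ => 1) m = a - b).
      { unfold lap, a, b. rewrite <- rsum_scal, <- rsum_minus. apply rsum_ext. intros; ring. }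
      assert (Hab : D / 8 <= a + b).
      { eapply Rle_trans; [apply Hdg|]. unfold a, b. rewrite <- rsum_scal, <- rsum_plus.
        apply rsum_le. intros i Hi. destruct (gd_w0 i Hi), (gd_w0 m Hm).
        pose proof (gd_f0 m i). pose proof (gd_f0 i m). nra. }
      pose proof (Rle_abs (- lap n w f (fun _ => 1) m)) as Hb. rewrite Rabs_Ropp in Hb.
      assert (30 * (K * K) * D * tau <= D / 16); [|lra].
      assert (K * K * tau <= M * tau / 10000000000) by nra.
      assert (K * K * tau <= / 10000000000) by lra. nra. }
    assert (Hdm : d m * a = rsum n (fun i => w i * d i * f i m) - lap n w f (fun _ => 1) m).
    { assert (E : lap n w f d m = - lap n w f (fun _ => 1) m).
      { rewrite (lap_lin n w f 1 (-1) x (fun _ => 1) d m Hm) by (intros; unfold d; ring).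
        rewrite Hx by easy. ring. }
      rewrite <- (Ropp_involutive (lap n w f (fun _ => 1) m)), <- E. unfold lap.
      rewrite rsum_minus. unfold a.
      rewrite (rsum_scal n (w m * d m) (f m)).
      change (rsum n (fun i => f m i)) with (rsum n (f m)). ring. }
    (* Split [d] as [z] plus [eta m]. Against [z], Cauchy-Schwarz is enough, as the edge weights at
       [m] have l2 norm at most [sqrt (3 * D) <= D]; the [eta] part is [T]. *)
    assert (Hsumd : Rabs (rsum n (fun i => w i * d i * f i m)) <= K * (D * Z + D * Q)).
    { rewrite <- HQ. destruct g. eapply Rle_trans; [apply rsum_abs|].
      apply Rle_trans with (K * (rsum n (fun i => (f m i + f i m) * Rabs (z i)) + T)).
      - unfold T. rewrite <- rsum_plus, <- rsum_scal. apply rsum_le. intros i Hi.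
        pose proof (gd_f0 m i). pose proof (gd_f0 i m). destruct (gd_w0 i Hi).
        rewrite !Rabs_mult, (Rabs_right (w i)), (Rabs_right (f i m)) by lra.
        assert (Rabs (d i) <= Rabs (z i) + Rabs (eta m i)).
        { replace (d i) with (z i + eta m i) by (unfold d, z; ring). apply Rabs_triang. }
        pose proof (Rabs_pos (d i)).
        apply Rle_trans with (K * Rabs (d i) * f i m); [repeat apply Rmult_le_compat_r; lra|].
        rewrite Rmult_assoc. apply Rmult_le_compat_l; [lra|].
        apply Rle_trans with (Rabs (d i) * (f m i + f i m)); [apply Rmult_le_compat_l; lra|].
        apply (Rmult_le_compat_r (f m i + f i m)) in H3; lra.
      - apply Rmult_le_compat_l; [lra|]. apply Rplus_le_compat_r.
        eapply Rle_trans with (rsum n (fun i => Rabs (f m i + f i m) * Rabs (z i))).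
        { apply rsum_le. intros i _. apply Rmult_le_compat_r; [apply Rabs_pos|apply Rle_abs]. }
        eapply Rle_trans; [apply (cauchy_schwarz n (fun i => f m i + f i m) z)|]. fold Z.
        apply Rmult_le_compat_r; [easy|]. apply norm2_le; [lra|].
        destruct (gd_deg0 m Hm) as [_ Hdg].
        apply Rle_trans with (3 * D).
        + eapply Rle_trans; [|apply Hdg]. apply rsum_le. intros i _.
          pose proof (gd_f0 m i). pose proof (gd_f0 i m). pose proof (gd_f2 m i). nra.
        + nra. }
    assert (Hfin : Rabs (d m) <= 32 * (30 * (K * K) * tau + K * Z + K * Q)).
    { apply Rmult_le_reg_l with (D / 32); [lra|].
      apply Rle_trans with (Rabs (d m * a)).
      - rewrite Rabs_mult, (Rabs_right a) by lra. rewrite Rmult_comm.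
        apply Rmult_le_compat_l; [apply Rabs_pos|easy].
      - rewrite Hdm. unfold Rminus at 1. eapply Rle_trans; [apply Rabs_triang|]. rewrite Rabs_Ropp.
        destruct g. specialize (gd_row0 m Hm).
        assert (0 <= D * (K * Z)) by (repeat apply Rmult_le_pos; lra). lra. }
    assert (HKZ : K * Z <= 3072 * (K * K * Q) + 95232 * (K * K * K * tau)).
    { unfold B in HZb. apply (Rmult_le_compat_l K) in HZb; lra. }
    assert (HKQ : K * Q <= K * K * Q) by (apply Rmult_le_compat_r; lra).
    (* This term produces the [K^4] of [M]; the same [M] makes the coefficient of [X] tiny. *)
    assert (HKKQ : K * K * Q <= 100000 * (K * K * K * K * tau) + / 1000000000 * X).
    { apply Rle_trans with (K * K * (100000 * (K * K) * tau + 7 / M * X)).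
      - apply Rmult_le_compat_l; lra.
      - assert (K * K * (/ M * X) <= / 10000000000 * X); [|lra].
        rewrite <- Rmult_assoc. apply Rmult_le_compat_r; [easy|].
        apply Rmult_le_reg_r with M; [lra|]. rewrite Rmult_assoc, Rinv_l by lra. lra. }
    assert (K * K * K * tau <= K * K * K * K * tau) by (apply Rmult_le_compat_r; lra).
    assert (K * K * tau <= K * K * K * K * tau) by (apply Rmult_le_compat_r; lra).
    assert (HMt : M * tau = 10000000000 * (K * K * K * K * tau)) by (destruct g as [? -> ]; ring).
    assert (0 <= K * K * K * K * tau) by (apply Rmult_le_pos; lra).
    lra. }
  intros m Hm. change (Rabs (d m) <= 2 * M * tau).
  assert (X <= M * tau + X / 2).
  { apply linf_le; [|easy]. assert (0 <= M * tau) by nra. lra. }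
  pose proof (linf_ge n d m Hm). fold X in H0. lra.
Qed.

(** * Independent bits *)

Definition upd (g : nat -> bool) (k : nat) (b : bool) (i : nat) : bool :=
  if Nat.eqb i k then b else g i.

Lemma upd_same g k b b' : upd (upd g k b) k b' = upd g k b'.
Proof. apply functional_extensionality; intros i. unfold upd. now destruct (Nat.eqb i k). Qed.

Lemma upd_comm g k b j b' : j <> k -> upd (upd g k b) j b' = upd (upd g j b') k b.
Proof.
  intros H. apply functional_extensionality; intros i. unfold upd.
  destruct (Nat.eqb_spec i j), (Nat.eqb_spec i k); congruence.
Qed.

Lemma upd_eq g k b : upd g k b k = b.
Proof. unfold upd. now rewrite Nat.eqb_refl. Qed.

Lemma upd_neq g k b i : i <> k -> upd g k b i = g i.
Proof. intros H. unfold upd. now destruct (Nat.eqb_spec i k). Qed.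

Lemma bexp_S m q F : bexp (S m) q F =
  q m * bexp m q (fun g => F (upd g m true)) + (1 - q m) * bexp m q (fun g => F (upd g m false)).
Proof. reflexivity. Qed.

Lemma bexp_ext m q F G : (forall g, F g = G g) -> bexp m q F = bexp m q G.
Proof. intros H. f_equal. now apply functional_extensionality. Qed.

Lemma bexp_plus m q : forall F G, bexp m q (fun g => F g + G g) = bexp m q F + bexp m q G.
Proof.
  induction m as [|m IH]; intros F G; [reflexivity|]. rewrite !bexp_S.
  rewrite (IH (fun g => F (upd g m true)) (fun g => G (upd g m true))).
  rewrite (IH (fun g => F (upd g m false)) (fun g => G (upd g m false))). ring.
Qed.

Lemma bexp_scal m q c : forall F, bexp m q (fun g => c * F g) = c * bexp m q F.
Proof.
  induction m as [|m IH]; intros F; [reflexivity|]. rewrite !bexp_S.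
  rewrite (IH (fun g => F (upd g m true))), (IH (fun g => F (upd g m false))). ring.
Qed.

Lemma bexp_const m q c : bexp m q (fun _ => c) = c.
Proof. induction m as [|m IH]; [reflexivity|]. rewrite bexp_S, IH. ring. Qed.

Lemma bexp_mono m q : (forall k, 0 <= q k <= 1) ->
  forall F G, (forall g, F g <= G g) -> bexp m q F <= bexp m q G.
Proof.
  intros Hq. induction m as [|m IH]; intros F G H; [apply H|]. rewrite !bexp_S.
  destruct (Hq m). apply Rplus_le_compat; apply Rmult_le_compat_l; try lra; apply IH; auto.
Qed.

(** The recursion of [bexp] exposes only the last bit. Since updates at distinct indices commute,
    any bit can be integrated first, which replaces conditioning on the others. *)
Lemma bexp_average m q k : (k < m)%nat -> forall F, bexp m q F =
  bexp m q (fun g => q k * F (upd g k true) + (1 - q k) * F (upd g k false)).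
Proof.
  induction m as [|m IH]; intros Hk F; [lia|]. rewrite !bexp_S.
  destruct (Nat.eq_dec k m) as [->|Hkm].
  - rewrite !(bexp_ext m q (fun g => q m * F (upd (upd g m _) m true) + (1 - q m) * F (upd (upd g m _) m false))
      (fun g => q m * F (upd g m true) + (1 - q m) * F (upd g m false))) by (intros; now rewrite !upd_same).
    rewrite bexp_plus, !bexp_scal. ring.
  - f_equal; f_equal; (rewrite IH by lia; apply bexp_ext; intros g;
      now rewrite !(upd_comm g _ _ m) by lia).
Qed.

(** Stated through the failure probability, so that union bounds simply add the constants. *)
Definition whp (m : nat) (q : nat -> R) (c : R) (P : (nat -> bool) -> Prop) : Prop :=
  bexp m q (fun g => indic (~ P g)) <= c.

Lemma indic_true (P : Prop) : P -> indic P = 1.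
Proof. intros H. unfold indic. now destruct excluded_middle_informative. Qed.

Lemma indic_false (P : Prop) : ~ P -> indic P = 0.
Proof. intros H. unfold indic. now destruct excluded_middle_informative. Qed.

Lemma indic_bounds (P : Prop) : 0 <= indic P <= 1.
Proof. unfold indic. destruct excluded_middle_informative; lra. Qed.

Lemma whp_bexp m q c P : whp m q c P -> bexp m q (fun g => indic (P g)) >= 1 - c.
Proof.
  intros H. unfold whp in H.
  assert (E : bexp m q (fun g => indic (P g)) = 1 + - 1 * bexp m q (fun g => indic (~ P g))); [|lra].
  rewrite <- (bexp_const m q 1) at 1. rewrite <- bexp_scal, <- bexp_plus. apply bexp_ext. intros g.
  destruct (excluded_middle_informative (P g)) as [h|h];
    [rewrite indic_true, indic_false by tauto|rewrite indic_false, indic_true by tauto]; ring.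
Qed.

Section Whp.
Context (m : nat) (q : nat -> R) (Hq : forall k, 0 <= q k <= 1).

Lemma whp_mono c c' (P Q : (nat -> bool) -> Prop) :
  whp m q c P -> c <= c' -> (forall g, P g -> Q g) -> whp m q c' Q.
Proof.
  intros H Hc HPQ. unfold whp in *. eapply Rle_trans; [|eapply Rle_trans; [apply H|easy]].
  apply bexp_mono; [easy|]. intros g. specialize (HPQ g). pose proof (indic_bounds (~ P g)).
  destruct (excluded_middle_informative (Q g)); [rewrite indic_false by tauto; lra|].
  rewrite !indic_true by tauto. lra.
Qed.

Lemma whp_always (P : (nat -> bool) -> Prop) : (forall g, P g) -> whp m q 0 P.
Proof.
  intros H. unfold whp. rewrite <- (bexp_const m q 0). right. apply bexp_ext.
  intros g. apply indic_false. auto.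
Qed.

Lemma whp_and c c' P Q : whp m q c P -> whp m q c' Q -> whp m q (c + c') (fun g => P g /\ Q g).
Proof.
  intros H H'. unfold whp in *. eapply Rle_trans; [|apply Rplus_le_compat; [apply H|apply H']].
  rewrite <- bexp_plus. apply bexp_mono; [easy|]. intros g.
  pose proof (indic_bounds (~ P g)). pose proof (indic_bounds (~ Q g)).
  destruct (excluded_middle_informative (P g)), (excluded_middle_informative (Q g)).
  - rewrite (indic_false (~ (_ /\ _))) by tauto. lra.
  - rewrite (indic_true (~ Q g)), indic_true by tauto. lra.
  - rewrite (indic_true (~ P g)), indic_true by tauto. lra.
  - rewrite (indic_true (~ P g)), indic_true by tauto. lra.
Qed.

Lemma whp_forall n c (P : nat -> (nat -> bool) -> Prop) :
  (forall i, (i < n)%nat -> whp m q c (P i)) ->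
  whp m q (INR n * c) (fun g => forall i, (i < n)%nat -> P i g).
Proof.
  induction n as [|n IH]; intros H.
  - apply (whp_mono 0 _ (fun _ => True)); [now apply whp_always|simpl; lra|intros; lia].
  - apply (whp_mono (INR n * c + c) _ (fun g => (forall i, (i < n)%nat -> P i g) /\ P n g)).
    + apply whp_and; [apply IH; intros|]; apply H; lia.
    + rewrite S_INR. lra.
    + intros g [H1 H2] i Hi. destruct (Nat.eq_dec i n) as [->|]; [easy|apply H1; lia].
Qed.

(** * Exponential moments given the bits outside a set *)

Definition invariant {A : Type} (T : nat -> Prop) (W : (nat -> bool) -> A) : Prop :=
  forall g k b, T k -> W (upd g k b) = W g.

(* Conditionally on the bits outside T, exp Z has expectation at most 1. *)
Definition submult (T : nat -> Prop) (Z : (nat -> bool) -> R) : Prop :=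
  forall W, (forall g, 0 <= W g) -> invariant T W ->
  bexp m q (fun g => W g * exp (Z g)) <= bexp m q W.

Lemma submult_nonpos T Z : (forall g, Z g <= 0) -> submult T Z.
Proof.
  intros H W HW _. apply bexp_mono; [easy|]. intros g.
  assert (exp (Z g) <= 1).
  { rewrite <- exp_0. destruct (H g) as [h|h]; [left; now apply exp_increasing|now rewrite h; right]. }
  specialize (HW g). nra.
Qed.

Lemma submult_weaken (T T' : nat -> Prop) Z : (forall k, T k -> T' k) -> submult T Z -> submult T' Z.
Proof. intros H HZ W HW Hinv. apply HZ; [easy|]. intros g k b Hk. apply Hinv. auto. Qed.

Lemma submult_bit k Z : (k < m)%nat ->
  (forall g, q k * exp (Z (upd g k true)) + (1 - q k) * exp (Z (upd g k false)) <= 1) ->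
  submult (eq k) Z.
Proof.
  intros Hk H W HW Hinv. rewrite (bexp_average m q k Hk (fun g => W g * exp (Z g))).
  apply bexp_mono; [easy|]. intros g. rewrite !Hinv by easy.
  specialize (H g). specialize (HW g).
  replace (_ + _) with (W g * (q k * exp (Z (upd g k true)) + (1 - q k) * exp (Z (upd g k false)))) by ring.
  rewrite <- (Rmult_1_r (W g)) at 2. now apply Rmult_le_compat_l.
Qed.

(** [exp (Z1 g)] is absorbed into the test function for [Z2]. The condition is one-sided: [Z2] may
    depend on the bits in [T1], as in a supermartingale. *)
Lemma submult_plus (T1 T2 : nat -> Prop) Z1 Z2 : invariant T2 Z1 -> submult T1 Z1 -> submult T2 Z2 ->
  submult (fun k => T1 k \/ T2 k) (fun g => Z1 g + Z2 g).
Proof.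
  intros Hinv H1 H2 W HW HWinv.
  rewrite (bexp_ext m q _ (fun g => (W g * exp (Z1 g)) * exp (Z2 g))) by (intros; rewrite exp_plus; ring).
  eapply Rle_trans; [apply H2|apply H1].
  - intros g. apply Rmult_le_pos; [easy|left; apply exp_pos].
  - intros g k b Hk. rewrite HWinv by tauto. now rewrite Hinv.
  - easy.
  - intros g k b Hk. apply HWinv. tauto.
Qed.

Lemma submult_rsum J (T : nat -> nat -> Prop) (Z : nat -> (nat -> bool) -> R) :
  (forall j, (j < J)%nat -> submult (T j) (Z j)) ->
  (forall i j, (i < j < J)%nat -> invariant (T j) (Z i)) ->
  submult (fun k => exists j, (j < J)%nat /\ T j k) (fun g => rsum J (fun j => Z j g)).
Proof.
  induction J as [|J IH]; intros H Hinv; [apply submult_nonpos; intros; simpl; lra|].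
  simpl. apply (submult_weaken (fun k => (exists j, (j < J)%nat /\ T j k) \/ T J k)).
  - intros k [[j [Hj Hk]]|Hk]; [exists j|exists J]; split; auto; lia.
  - apply (submult_plus _ (T J) (fun g => rsum J (fun j => Z j g)) (Z J)); [|apply IH|apply H; lia].
    + intros g k b Hk. apply rsum_ext. intros i Hi. apply (Hinv i J); [lia|easy].
    + intros; apply H; lia.
    + intros; apply Hinv; lia.
Qed.

(* Markov applied to exp (Z - t). *)
Lemma whp_submult T Z t : submult T Z -> whp m q (exp (- t)) (fun g => Z g < t).
Proof.
  intros H. unfold whp.
  apply Rle_trans with (bexp m q (fun g => exp (- t) * (1 * exp (Z g)))).
  - apply bexp_mono; [easy|]. intros g. rewrite Rmult_1_l, <- exp_plus.
    destruct (Rlt_dec (Z g) t) as [h|h]; [rewrite indic_false by tauto; left; apply exp_pos|].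
    rewrite indic_true by easy. rewrite <- exp_0.
    destruct (Req_dec (Z g) t) as [->|]; [right; f_equal; lra|left; apply exp_increasing; lra].
  - rewrite (bexp_scal m q (exp (- t)) (fun g => 1 * exp (Z g))).
    rewrite <- (Rmult_1_r (exp (- t))) at 2. apply Rmult_le_compat_l; [left; apply exp_pos|].
    apply Rle_trans with (bexp m q (fun _ => 1)); [|rewrite bexp_const; lra].
    apply (H (fun _ => 1)); [intros; lra|easy].
Qed.

End Whp.

(** * Moment inequalities for one Bernoulli variable *)

Lemma exp_upper s : s < 1 -> exp s <= / (1 - s).
Proof.
  intros H. rewrite <- (Ropp_involutive s) at 1. rewrite exp_Ropp.
  apply Rinv_le_contravar; [lra|]. pose proof (exp_ineq1_le (- s)). lra.
Qed.

(* Replacing s by t (b - E b) kills the linear term, which gives the sub-Gaussian bound. *)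
Lemma exp_le_quadratic s : exp s <= s + exp (2 * (s * s)).
Proof.
  pose proof (exp_ineq1_le (2 * (s * s))).
  destruct (Rle_lt_dec s (/ 2)) as [Hs|Hs].
  - apply Rle_trans with (1 + s + 2 * (s * s)); [|lra].
    eapply Rle_trans; [apply exp_upper; lra|].
    apply Rmult_le_reg_r with (1 - s); [lra|]. rewrite Rinv_l by lra. nra.
  - assert (exp s <= exp (2 * (s * s))); [|lra].
    destruct (Req_dec s (2 * (s * s))) as [<-|]; [lra|]. left. apply exp_increasing. nra.
Qed.

Lemma exp_le_mono a b : a <= b -> exp a <= exp b.
Proof. intros [H| ->]; [left; now apply exp_increasing|lra]. Qed.

Lemma bernoulli_subgaussian q t : 0 <= q <= 1 ->
  q * exp (t * (1 - q) - 2 * (t * t)) + (1 - q) * exp (t * (0 - q) - 2 * (t * t)) <= 1.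
Proof.
  intros Hq. unfold Rminus at 1 4. rewrite !exp_plus, exp_Ropp.
  pose proof (exp_pos (2 * (t * t))) as Hp.
  assert (Hsq : forall u, -1 <= u <= 1 -> 2 * (t * u * (t * u)) <= 2 * (t * t)).
  { intros u Hu. replace (2 * (t * u * (t * u))) with (2 * (t * t) * (u * u)) by ring.
    rewrite <- (Rmult_1_r (2 * (t * t))) at 2. apply Rmult_le_compat_l; nra. }
  assert (H1 : exp (t * (1 - q)) <= t * (1 - q) + exp (2 * (t * t))).
  { eapply Rle_trans; [apply exp_le_quadratic|]. apply Rplus_le_compat_l, exp_le_mono, Hsq. lra. }
  assert (H2 : exp (t * (0 - q)) <= t * (0 - q) + exp (2 * (t * t))).
  { eapply Rle_trans; [apply exp_le_quadratic|]. apply Rplus_le_compat_l, exp_le_mono, Hsq. lra. }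
  apply Rmult_le_reg_r with (exp (2 * (t * t))); [easy|].
  replace (_ * exp (2 * (t * t))) with (q * exp (t * (1 - q)) + (1 - q) * exp (t * (0 - q))) by (field; lra).
  nra.
Qed.

(** On [[0, 1]] one has [exp a <= 1 + 2 * a], so the moment is at most
    [1 + 2 * p * a <= exp (2 * p * a)]. The compensator linear in [a] is what allows weighted
    degrees. *)
Lemma bernoulli_upper p a : 0 <= p <= 1 -> 0 <= a <= 1 ->
  p * exp (a * 1 - 2 * p * a) + (1 - p) * exp (a * 0 - 2 * p * a) <= 1.
Proof.
  intros Hp Ha. rewrite Rmult_0_r, Rmult_1_r. unfold Rminus at 1 3. rewrite Rplus_0_l, exp_plus.
  assert (He : exp a <= 1 + 2 * a).
  { destruct (Rle_lt_dec a (/ 2)) as [h|h].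
    - eapply Rle_trans; [apply exp_upper; lra|].
      apply Rmult_le_reg_r with (1 - a); [lra|]. rewrite Rinv_l by lra. nra.
    (* Here [exp a <= 3 / (2 - a)], and [(1 + 2 * a) * (2 - a) - 3] is a concave quadratic that
       vanishes at 1/2 and at 1. *)
    - replace a with (1 + - (1 - a)) at 1 by ring. rewrite exp_plus, exp_Ropp.
      assert (/ exp (1 - a) <= / (2 - a)).
      { apply Rinv_le_contravar; [lra|]. pose proof (exp_ineq1_le (1 - a)). lra. }
      assert (0 < / (2 - a)) by (apply Rinv_0_lt_compat; lra).
      pose proof exp_le_3. pose proof (exp_pos 1).
      apply Rle_trans with (3 * / (2 - a)).
      + apply Rmult_le_compat; try lra. left. apply Rinv_0_lt_compat, exp_pos.
      + apply Rmult_le_reg_r with (2 - a); [lra|]. rewrite Rmult_assoc, Rinv_l by lra. nra. }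
  replace (_ + _) with (exp (- (2 * p * a)) * (1 + p * (exp a - 1))) by ring.
  pose proof (exp_pos (- (2 * p * a))).
  apply Rle_trans with (exp (- (2 * p * a)) * exp (2 * p * a)).
  - apply Rmult_le_compat_l; [lra|]. pose proof (exp_ineq1_le (2 * p * a)). nra.
  - rewrite <- exp_plus, Rplus_opp_l, exp_0. lra.
Qed.

(** As [exp (-1) <= / 2], the moment of minus the bit is at most [1 - p / 2 <= exp (- (p / 2))]. *)
Lemma bernoulli_lower p : 0 <= p <= 1 -> p * exp (p / 2 - 1) + (1 - p) * exp (p / 2 - 0) <= 1.
Proof.
  intros Hp. unfold Rminus at 1 3. rewrite Ropp_0, Rplus_0_r, exp_plus.
  assert (He : exp (- (1)) <= / 2).
  { rewrite exp_Ropp. apply Rinv_le_contravar; [lra|]. pose proof (exp_ineq1_le 1). lra. }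
  pose proof (exp_pos (p / 2)).
  apply Rle_trans with (exp (p / 2) * exp (- (p / 2))).
  - pose proof (exp_ineq1_le (- (p / 2))).
    replace (_ + _) with (exp (p / 2) * (1 - p + p * exp (- (1)))) by ring.
    apply Rmult_le_compat_l; [lra|]. nra.
  - rewrite <- exp_plus, Rplus_opp_r, exp_0. lra.
Qed.

(** * Concentration *)

(** Total of the failure bounds over all subsets, peeled bit by bit so that the union bound is an
    induction on [n]. *)
Fixpoint subset_sum (n : nat) (c : (nat -> bool) -> R) : R :=
  match n with
  | O => c (fun _ => false)
  | S k => subset_sum k (fun S => c (upd S k true)) + subset_sum k (fun S => c (upd S k false))
  end.

Fixpoint card (n : nat) (S : nat -> bool) : nat :=
  match n with O => O | Datatypes.S k => (card k S + if S k then 1 else 0)%nat end.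

Lemma card_ext n S S' : (forall i, (i < n)%nat -> S i = S' i) -> card n S = card n S'.
Proof.
  induction n as [|n IH]; intros H; simpl; [reflexivity|].
  rewrite IH by (intros; apply H; lia). now rewrite H by lia.
Qed.

Lemma INR_card n S : INR (card n S) = rsum n (fun i => b2R (S i)).
Proof.
  induction n as [|n IH]; simpl; [reflexivity|]. rewrite plus_INR, IH.
  destruct (S n); simpl; lra.
Qed.

Lemma card_compl n S : (card n S + card n (fun i => negb (S i)) = n)%nat.
Proof. induction n as [|n IH]; simpl; [reflexivity|]. destruct (S n); simpl; lia. Qed.

Lemma subset_sum_ext n c c' : (forall S, c S = c' S) -> subset_sum n c = subset_sum n c'.
Proof. intros H. f_equal. now apply functional_extensionality. Qed.

Lemma subset_sum_plus n : forall c c',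
  subset_sum n (fun S => c S + c' S) = subset_sum n c + subset_sum n c'.
Proof.
  induction n as [|n IH]; intros c c'; simpl; [reflexivity|].
  rewrite (IH (fun S => c (upd S n true)) (fun S => c' (upd S n true))).
  rewrite (IH (fun S => c (upd S n false)) (fun S => c' (upd S n false))). ring.
Qed.

(** The binomial theorem; taking [u] to be the identity or [negb] covers the powers of the size of
    [S] and of its complement at once. *)
Lemma subset_sum_pow n (u : bool -> bool) (r : R) : (forall b, u (negb b) = negb (u b)) ->
  forall a, subset_sum n (fun S => a * r ^ card n (fun i => u (S i))) = a * (1 + r) ^ n.
Proof.
  intros Hu. induction n as [|n IH]; intros a; simpl; [ring|].
  assert (H : forall b, subset_sum n (fun S => a * r ^ (card n (fun i => u (upd S n b i))
       + (if u (upd S n b n) then 1 else 0))) = (a * if u b then r else 1) * (1 + r) ^ n).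
  { intros b. rewrite <- IH. apply subset_sum_ext. intros S. rewrite upd_eq.
    rewrite (card_ext n (fun i => u (upd S n b i)) (fun i => u (S i)))
      by (intros; now rewrite upd_neq by lia).
    rewrite Nat.add_comm. destruct (u b); simpl; ring. }
  rewrite !H, (Hu true : u false = _). destruct (u true); simpl; ring.
Qed.

Lemma whp_forall_subsets m q : (forall k, 0 <= q k <= 1) -> forall n c (P : (nat -> bool) -> (nat -> bool) -> Prop),
  (forall S, whp m q (c S) (P S)) ->
  whp m q (subset_sum n c) (fun g => forall S, (forall i, (n <= i)%nat -> S i = false) -> P S g).
Proof.
  intros Hq n. induction n as [|n IH]; intros c P H.
  - apply (whp_mono m q Hq _ _ _ _ (H (fun _ => false))); [simpl; lra|].
    intros g Hg S HS. replace S with (fun _ : nat => false); [easy|].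
    apply functional_extensionality. intros i. symmetry. apply HS. lia.
  - simpl. apply (whp_mono m q Hq _ _ _ _ (whp_and m q Hq _ _ _ _
      (IH (fun S => c (upd S n true)) (fun S => P (upd S n true)) (fun S => H _))
      (IH (fun S => c (upd S n false)) (fun S => P (upd S n false)) (fun S => H _)))); [lra|].
    intros g [Ht Hf] S HS.
    assert (E : S = upd (upd S n false) n (S n)).
    { apply functional_extensionality. intros i. rewrite upd_same. unfold upd.
      destruct (Nat.eqb_spec i n) as [->|]; reflexivity. }
    assert (Hs : forall i, (n <= i)%nat -> upd S n false i = false).
    { intros i Hi. unfold upd. destruct (Nat.eqb_spec i n); [reflexivity|apply HS; lia]. }
    rewrite E. destruct (S n); [now apply Ht|now apply Hf].
Qed.

(** Only the entry with the smaller item first carries a bit; sorting the pair gives both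
    orientations the same index. *)
Definition eidx (n i j : nat) : nat := (Nat.min i j * n + Nat.max i j)%nat.
Definition cidx (n L i j l : nat) : nat := (n * n + eidx n i j * L + l)%nat.

Lemma pair_inj n i j i' j' : (j < n)%nat -> (j' < n)%nat -> (i * n + j = i' * n + j')%nat -> i = i' /\ j = j'.
Proof.
  intros H H' E.
  assert (i = i').
  { rewrite (Nat.div_unique (i * n + j) n i j), E by lia.
    symmetry. apply (Nat.div_unique _ n i' j'); lia. }
  subst. split; lia.
Qed.

Lemma eidx_sym n i j : eidx n i j = eidx n j i.
Proof. unfold eidx. now rewrite Nat.min_comm, Nat.max_comm. Qed.

Lemma eidx_lt n i j : (i < n)%nat -> (j < n)%nat -> (eidx n i j < n * n)%nat.
Proof. intros. unfold eidx. assert (Nat.min i j <= n - 1)%nat by lia. nia. Qed.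

Lemma eidx_inj n i j i' j' : (i < n)%nat -> (j < n)%nat -> (i' < n)%nat -> (j' < n)%nat ->
  eidx n i j = eidx n i' j' -> (i = i' /\ j = j') \/ (i = j' /\ j = i').
Proof. intros ? ? ? ? E. apply pair_inj in E; lia. Qed.

Lemma cidx_lt n L i j l : (i < n)%nat -> (j < n)%nat -> (l < L)%nat -> (cidx n L i j l < nvars n L)%nat.
Proof. intros Hi Hj Hl. pose proof (eidx_lt n i j Hi Hj). unfold cidx, nvars. nia. Qed.

Lemma edge_eidx n g i j : i <> j -> edge n g i j = g (eidx n i j).
Proof.
  intros H. unfold edge, eidx. destruct (Nat.ltb_spec i j); [|destruct (Nat.ltb_spec j i)]; f_equal; lia.
Qed.

Lemma edge_diag n g i : edge n g i i = false.
Proof. unfold edge. now rewrite Nat.ltb_irrefl. Qed.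

Lemma edge_sym n g i j : edge n g i j = edge n g j i.
Proof.
  destruct (Nat.eq_dec i j) as [->|H]; [reflexivity|].
  rewrite !edge_eidx by lia. f_equal. apply eidx_sym.
Qed.

Lemma edge_upd n g k b i j : eidx n i j <> k -> edge n (upd g k b) i j = edge n g i j.
Proof.
  intros H. destruct (Nat.eq_dec i j) as [->|Hij]; [now rewrite !edge_diag|].
  rewrite !edge_eidx by easy. now apply upd_neq.
Qed.

Lemma ybit_cidx n L g i j l : i <> j ->
  ybit n L g i j l = if Nat.ltb i j then g (cidx n L i j l) else negb (g (cidx n L i j l)).
Proof.
  intros H. unfold ybit, cidx, eidx. destruct (Nat.ltb_spec i j); [|f_equal]; do 2 f_equal; nia.
Qed.

Lemma yavg_upd_edge n L g k b i j : (k < n * n)%nat -> yavg n L (upd g k b) i j = yavg n L g i j.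
Proof.
  intros H. unfold yavg. f_equal. apply rsum_ext. intros l _. f_equal. unfold ybit.
  destruct (Nat.ltb i j); [|f_equal]; apply upd_neq; lia.
Qed.

Lemma bprob_eidx n L p w i j : (i < n)%nat -> (j < n)%nat -> i <> j -> bprob n L p w (eidx n i j) = p.
Proof.
  intros Hi Hj H. unfold bprob. pose proof (eidx_lt n i j Hi Hj) as Hlt.
  destruct (Nat.ltb_spec (eidx n i j) (n * n)); [|lia]. unfold eidx.
  rewrite <- (Nat.div_unique _ n (Nat.min i j) (Nat.max i j)) by lia.
  rewrite <- (Nat.mod_unique _ n (Nat.min i j) (Nat.max i j)) by lia.
  destruct (Nat.ltb_spec (Nat.min i j) (Nat.max i j)); [reflexivity|lia].
Qed.

Lemma bprob_cidx n L p w i j l : (i < n)%nat -> (j < n)%nat -> i <> j -> (l < L)%nat ->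
  bprob n L p w (cidx n L i j l) = w (Nat.max i j) / (w (Nat.min i j) + w (Nat.max i j)).
Proof.
  intros Hi Hj H Hl. unfold bprob.
  destruct (Nat.ltb_spec (cidx n L i j l) (n * n)) as [h|_]; [unfold cidx in h; lia|]. cbv zeta.
  replace (cidx n L i j l - n * n)%nat with (eidx n i j * L + l)%nat by (unfold cidx; lia).
  rewrite <- (Nat.div_unique (eidx n i j * L + l) L (eidx n i j) l) by lia. unfold eidx.
  rewrite <- (Nat.div_unique _ n (Nat.min i j) (Nat.max i j)) by lia.
  rewrite <- (Nat.mod_unique _ n (Nat.min i j) (Nat.max i j)) by lia.
  destruct (Nat.ltb_spec (Nat.min i j) (Nat.max i j)); [reflexivity|lia].
Qed.

Lemma bprob_bounds n L p w : (1 <= n)%nat -> 0 <= p <= 1 -> (forall i, (i < n)%nat -> 0 < w i) ->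
  forall k, 0 <= bprob n L p w k <= 1.
Proof.
  intros Hn Hp Hw k. unfold bprob. cbv zeta.
  destruct (Nat.ltb k (n * n)); [destruct Nat.ltb; lra|].
  set (j := Nat.modulo _ n). set (i := Nat.div _ n).
  destruct (Nat.ltb_spec i j) as [h|h]; [|lra].
  assert (Hj : (j < n)%nat) by (apply Nat.mod_upper_bound; lia).
  assert (Hwj := Hw j Hj). assert (Hwi := Hw i ltac:(lia)).
  split; [apply Rmult_le_pos; [lra|left; apply Rinv_0_lt_compat; lra]|].
  apply Rmult_le_reg_r with (w i + w j); [lra|]. unfold Rdiv. rewrite Rmult_assoc, Rinv_l by lra. lra.
Qed.

Lemma b2R_bounds b : 0 <= b2R b <= 1.
Proof. destruct b; simpl; lra. Qed.

(** * Tail bounds for degrees, comparisons and cuts *)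

Section Events.
Context (n L : nat) (p : R) (w : nat -> R) (Hn : (1 <= n)%nat) (HL : (1 <= L)%nat)
  (Hp : 0 <= p <= 1) (Hw : forall i, (i < n)%nat -> 0 < w i).

Let m0 := nvars n L.
Let q := bprob n L p w.
Let Hq : forall k, 0 <= q k <= 1 := bprob_bounds n L p w Hn Hp Hw.

Lemma eidx_bit i j : (i < n)%nat -> (j < n)%nat -> (eidx n i j < m0)%nat.
Proof. intros Hi Hj. pose proof (eidx_lt n i j Hi Hj). unfold m0, nvars. lia. Qed.

(** The weights may be random as long as they ignore the edge bits at [m]; this is where the
    leave-one-out independence enters. It serves both for plain degrees and for the weights
    [loo_weight]. *)
Lemma degree_chernoff m (a : nat -> (nat -> bool) -> R) t : (m < n)%nat ->
  (forall j g, (j < n)%nat -> 0 <= a j g <= 1) ->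
  (forall j i, (i < n)%nat -> i <> m -> invariant (eq (eidx n m i)) (a j)) ->
  whp m0 q (exp (- t)) (fun g =>
    rsum n (fun j => if Nat.eqb j m then 0 else a j g * b2R (edge n g m j) - 2 * p * a j g) < t).
Proof.
  intros Hm Ha Hinv.
  apply (whp_submult m0 q Hq (fun k => exists j, (j < n)%nat /\ (j <> m /\ eidx n m j = k))).
  apply (submult_rsum m0 q Hq n (fun j k => j <> m /\ eidx n m j = k)).
  - intros j Hj. destruct (Nat.eqb_spec j m) as [|Hjm]; [apply submult_nonpos; auto; intros; lra|].
    apply (submult_weaken m0 q (eq (eidx n m j))); [auto|].
    apply submult_bit; auto; [now apply eidx_bit|]. intros g.
    rewrite !(Hinv j j Hj Hjm) by easy. rewrite !edge_eidx, !upd_eq by lia. unfold q.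
    rewrite bprob_eidx by lia. simpl. apply bernoulli_upper; auto.
  - intros i j [Hij Hj] g k b [Hjm <-]. destruct (Nat.eqb_spec i m); [reflexivity|].
    rewrite !(Hinv i j Hj Hjm) by easy. rewrite edge_upd; [reflexivity|].
    intros E. apply eidx_inj in E; lia.
Qed.

(** The selector [beta] reads no comparison bits, so the graph is in effect fixed. The sub-Gaussian
    compensator stays inside the sum, since the number of selected terms is random; it is bounded
    later by the degree. *)
Lemma comparison_hoeffding m (beta : nat -> (nat -> bool) -> bool) (alpha : nat -> R) s t : (m < n)%nat ->
  (forall j, (j < n)%nat -> invariant (fun k => (n * n <= k)%nat) (beta j)) ->
  whp m0 q (exp (- t)) (fun g =>
    rsum n (fun j => if Nat.eqb j m then 0 else if beta j g then
      INR L * (s * alpha j * (yavg n L g j m - w m / (w j + w m)) - 2 * ((s * alpha j) * (s * alpha j)))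
      else 0) < t).
Proof.
  intros Hm Hinv.
  assert (HLpos : 0 < INR L) by (apply lt_0_INR; lia).
  assert (Hsub : submult m0 q (fun k => exists j, (j < n)%nat /\ exists l, (l < L)%nat /\ (j <> m /\ cidx n L j m l = k))
    (fun g => rsum n (fun j => rsum L (fun l => if Nat.eqb j m then 0 else if beta j g then
      s * alpha j * (b2R (ybit n L g j m l) - w m / (w j + w m)) - 2 * ((s * alpha j) * (s * alpha j)) else 0)))).
  { apply (submult_rsum m0 q Hq n (fun j k => exists l, (l < L)%nat /\ (j <> m /\ cidx n L j m l = k))).
    - intros j Hj. apply (submult_rsum m0 q Hq L (fun l k => j <> m /\ cidx n L j m l = k)).
      + intros l Hl. destruct (Nat.eqb_spec j m) as [|Hjm]; [apply submult_nonpos; auto; intros; lra|].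
        apply (submult_weaken m0 q (eq (cidx n L j m l))); [auto|].
        apply submult_bit; auto; [now apply cidx_lt|]. intros g.
        rewrite !(Hinv j Hj) by (unfold cidx; lia). pose proof (Hq (cidx n L j m l)) as Hqk.
        destruct (beta j g); [|rewrite exp_0; lra].
        rewrite !ybit_cidx, !upd_eq by lia. unfold q in *. rewrite bprob_cidx in * by lia.
        set (tt := s * alpha j). assert (Hwj := Hw j Hj). assert (Hwm := Hw m Hm).
        destruct (Nat.ltb_spec j m) as [h|h].
        * rewrite Nat.max_r, Nat.min_l in * by lia. now apply bernoulli_subgaussian.
        (* For [j > m] the stored bit belongs to the opposite orientation and is negated, so its
           probability is the complementary one. *)
        * rewrite Nat.max_l, Nat.min_r in * by lia. simpl.
          replace (w m / (w j + w m)) with (1 - w j / (w m + w j)) by (field; lra).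
          pose proof (bernoulli_subgaussian (1 - w j / (w m + w j)) tt ltac:(lra)) as Hb.
          replace (1 - (1 - w j / (w m + w j))) with (w j / (w m + w j)) in * by ring. lra.
      + intros i l [Hil Hl] g k b [Hjm <-]. destruct (Nat.eqb_spec j m); [easy|].
        rewrite (Hinv j Hj) by (unfold cidx; lia). rewrite !ybit_cidx by easy.
        rewrite !upd_neq by (unfold cidx; lia). reflexivity.
    - intros i j [Hij Hj] g k b [l [Hl [Hjm <-]]]. apply rsum_ext. intros l' Hl'.
      destruct (Nat.eqb_spec i m) as [|Him]; [easy|].
      rewrite (Hinv i) by (unfold cidx; lia). rewrite !ybit_cidx by easy.
      rewrite !upd_neq; [reflexivity|]. unfold cidx. intros E.
      assert (eidx n i m * L + l' = eidx n j m * L + l)%nat as E' by lia.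
      apply pair_inj in E' as [E' _]; try lia. apply eidx_inj in E'; lia. }
  apply (whp_submult m0 q Hq _ _ t) in Hsub.
  apply (whp_mono m0 q Hq _ _ _ _ Hsub); [lra|]. intros g Hg.
  erewrite rsum_ext; [apply Hg|]. intros j Hj. simpl.
  destruct (Nat.eqb j m); [now rewrite rsum_0|]. destruct (beta j g); [|now rewrite rsum_0].
  rewrite (rsum_ext L _ (fun l => s * alpha j * b2R (ybit n L g j m l) -
    (s * alpha j * (w m / (w j + w m)) + 2 * ((s * alpha j) * (s * alpha j))))) by (intros; ring).
  rewrite rsum_minus, rsum_scal, rsum_const. unfold yavg.
  set (Y := rsum L _). set (Q := w m / _). field. lra.
Qed.

(** The moment bound holds with [p / 2] per pair; falling below [p / 4] per pair therefore leaves an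
    excess of [p / 4] for each pair of the cut in the exponent. *)
Lemma cut_chernoff (S : nat -> bool) :
  whp m0 q (exp (- (p / 4 * rsum n (fun i => rsum n (fun j =>
      if Nat.ltb i j then Rabs (b2R (S i) - b2R (S j)) else 0)))))
    (fun g => rsum n (fun i => rsum n (fun j => if Nat.ltb i j then
      (p / 4 - b2R (edge n g i j)) * Rabs (b2R (S i) - b2R (S j)) else 0)) < 0).
Proof.
  set (V := fun i j => Rabs (b2R (S i) - b2R (S j))).
  assert (Hsub : submult m0 q (fun k => exists i, (i < n)%nat /\ exists j, (j < n)%nat /\ ((i < j)%nat /\ eidx n i j = k))
    (fun g => rsum n (fun i => rsum n (fun j => if Nat.ltb i j then
      (p / 2 - b2R (edge n g i j)) * V i j else 0)))).
  { apply (submult_rsum m0 q Hq n (fun i k => exists j, (j < n)%nat /\ ((i < j)%nat /\ eidx n i j = k))).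
    - intros i Hi. apply (submult_rsum m0 q Hq n (fun j k => (i < j)%nat /\ eidx n i j = k)).
      + intros j Hj. destruct (Nat.ltb_spec i j) as [Hij|]; [|apply submult_nonpos; auto; intros; lra].
        apply (submult_weaken m0 q (eq (eidx n i j))); [auto|].
        apply submult_bit; auto; [now apply eidx_bit|]. intros g.
        rewrite !edge_eidx, !upd_eq by lia. unfold q. rewrite bprob_eidx by lia. simpl.
        assert (V i j = 0 \/ V i j = 1) as [-> | ->].
        { unfold V. destruct (S i), (S j); simpl; unfold Rabs; destruct Rcase_abs; lra. }
        * rewrite !Rmult_0_r, exp_0. lra.
        * rewrite !Rmult_1_r. now apply bernoulli_lower.
      + intros j j' [Hjj Hj'] g k b [Hij <-]. destruct (Nat.ltb_spec i j); [|easy].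
        rewrite edge_upd; [easy|]. intros E. apply eidx_inj in E; lia.
    - intros i i' [Hii Hi'] g k b [j' [Hj' [Hij <-]]]. apply rsum_ext. intros j Hj.
      destruct (Nat.ltb_spec i j); [|easy].
      rewrite edge_upd; [easy|]. intros E. apply eidx_inj in E; lia. }
  apply (whp_submult m0 q Hq _ _ (p / 4 * rsum n (fun i => rsum n (fun j => if Nat.ltb i j then V i j else 0)))) in Hsub.
  apply (whp_mono m0 q Hq _ _ _ _ Hsub); [apply Rle_refl|]. intros g Hg.
  rewrite <- rsum_scal in Hg. apply Rlt_minus in Hg. rewrite <- rsum_minus in Hg.
  erewrite rsum_ext; [apply Hg|]. intros i _. simpl. rewrite <- rsum_scal, <- rsum_minus.
  apply rsum_ext. intros j _. destruct (Nat.ltb i j); fold (V i j); field.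
Qed.

Lemma rsum_upper_triangle h : (forall i j, h i j = h j i) -> (forall i, h i i = 0) ->
  rsum n (fun i => rsum n (h i)) = 2 * rsum n (fun i => rsum n (fun j => if Nat.ltb i j then h i j else 0)).
Proof.
  intros Hs Hd. set (T := rsum n (fun i => rsum n (fun j => if Nat.ltb i j then h i j else 0))).
  replace (2 * T) with (T + T) by ring. unfold T at 2.
  rewrite (rsum_swap n n (fun i j => if Nat.ltb i j then h i j else 0)).
  unfold T. rewrite <- rsum_plus. apply rsum_ext. intros i _. rewrite <- rsum_plus.
  apply rsum_ext. intros j _. rewrite (Hs j i).
  destruct (Nat.ltb_spec i j), (Nat.ltb_spec j i); try lia; try ring.
  replace j with i by lia. rewrite Hd. ring.
Qed.

Lemma cut_size S : rsum n (fun i => rsum n (fun j => if Nat.ltb i j then Rabs (b2R (S i) - b2R (S j)) else 0))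
  = INR (card n S) * INR (card n (fun i => negb (S i))).
Proof.
  set (V := fun i j => Rabs (b2R (S i) - b2R (S j))).
  apply Rmult_eq_reg_l with 2; [|lra].
  transitivity (rsum n (fun i => rsum n (V i))); [symmetry; apply (rsum_upper_triangle V)|].
  - intros i j. apply Rabs_minus_sym.
  - intros i. unfold V. rewrite Rminus_diag, Rabs_R0. reflexivity.
  - rewrite !INR_card. set (s := rsum n (fun i => b2R (S i))). set (s' := rsum n (fun i => b2R (negb (S i)))).
    transitivity (rsum n (fun i => s' * b2R (S i) + s * b2R (negb (S i)))).
    + apply rsum_ext. intros i _. unfold V, s, s'.
      rewrite (Rmult_comm (rsum n (fun i => b2R (negb (S i))))), (Rmult_comm (rsum n (fun i => b2R (S i)))).
      rewrite <- !rsum_scal, <- rsum_plus.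
      apply rsum_ext. intros j _. destruct (S i), (S j); simpl; unfold Rabs; destruct Rcase_abs; lra.
    + rewrite rsum_plus, !rsum_scal. fold s s'. ring.
Qed.

(* 0 ^ k is the indicator of k = 0, so the failure bounds of the trivial cuts lose their leading 1
   and the sum over all S is 2 ((1 + r)^n - 1). *)
Lemma cut_event (S : nat -> bool) : let r := exp (- (INR n * p / 8)) in
  whp m0 q ((1 * r ^ card n S + - 1 * 0 ^ card n S) +
            (1 * r ^ card n (fun i => negb (S i)) + - 1 * 0 ^ card n (fun i => negb (S i))))
    (fun g => 0 <= dirichlet1 n (fun i j => b2R (edge n g i j) - p / 4) (fun i => b2R (S i))).
Proof.
  intros r. set (s := card n S). set (s' := card n (fun i => negb (S i))).
  assert (Hr : 0 < r) by apply exp_pos.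
  assert (Hss : (s + s' = n)%nat) by apply card_compl.
  assert (Htri : forall g, dirichlet1 n (fun i j => b2R (edge n g i j) - p / 4) (fun i => b2R (S i)) =
     - 2 * rsum n (fun i => rsum n (fun j => if Nat.ltb i j then
      (p / 4 - b2R (edge n g i j)) * Rabs (b2R (S i) - b2R (S j)) else 0))).
  { intros g. unfold dirichlet1.
    rewrite (rsum_upper_triangle (fun i j => (b2R (edge n g i j) - p / 4) * Rabs (b2R (S i) - b2R (S j)))).
    - replace (-2) with (2 * -1) by ring. rewrite Rmult_assoc. f_equal. rewrite <- rsum_scal.
      apply rsum_ext. intros i _. rewrite <- rsum_scal. apply rsum_ext. intros j _.
      destruct (Nat.ltb i j); ring.
    - intros i j. now rewrite edge_sym, Rabs_minus_sym.
    - intros i. rewrite Rminus_diag, Rabs_R0. ring. }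
  pose proof (pow_le r s ltac:(lra)) as Hps. pose proof (pow_le r s' ltac:(lra)) as Hps'.
  assert (H0 : (0 < s)%nat /\ (0 < s')%nat \/ s = 0%nat \/ s' = 0%nat) by lia.
  destruct H0 as [[Hs Hs']|H0].
  - rewrite !pow_ne_zero by lia. apply (whp_mono m0 q Hq _ _ _ _ (cut_chernoff S)).
    + rewrite cut_size. fold s s'.
      assert (Hpow : forall k, r ^ k = exp (- (INR n * p / 8) * INR k)).
      { intros k. induction k as [|k IH]; [simpl; now rewrite Rmult_0_r, exp_0|].
        rewrite S_INR, Rmult_plus_distr_l, exp_plus, <- IH, Rmult_1_r. simpl. fold r. ring. }
      rewrite !Hpow.
      assert (HR : INR n = INR s + INR s') by (rewrite <- plus_INR; now f_equal).
      assert (1 <= INR s) by (change 1 with (INR 1); apply le_INR; lia).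
      assert (1 <= INR s') by (change 1 with (INR 1); apply le_INR; lia).
      set (a := - (INR n * p / 8) * INR s). set (b := - (INR n * p / 8) * INR s').
      pose proof (exp_pos a). pose proof (exp_pos b).
      (* The larger side has at least [n / 2] elements, so the exponent is at least [n * p / 8]
         times the size of the smaller side. *)
      destruct (Rle_lt_dec (INR s) (INR s')).
      * assert (exp (- (p / 4 * (INR s * INR s'))) <= exp a); [|lra].
        apply exp_le_mono. unfold a. rewrite HR.
        assert (0 <= p * INR s * (INR s' - INR s)) by (repeat apply Rmult_le_pos; lra). lra.
      * assert (exp (- (p / 4 * (INR s * INR s'))) <= exp b); [|lra].
        apply exp_le_mono. unfold b. rewrite HR.
        assert (0 <= p * INR s' * (INR s - INR s')) by (repeat apply Rmult_le_pos; lra). lra.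
    + intros g Hg. rewrite Htri. lra.
  - apply (whp_mono m0 q Hq 0 _ (fun _ => True)); [now apply whp_always| |].
    + assert (forall k, 0 ^ k <= 1) as Hk.
      { intros [|k]; simpl; lra. }
      pose proof (Hk s). pose proof (Hk s'). destruct H0 as [H0|H0].
      * assert (Hs'n : (0 < s')%nat) by lia. rewrite (pow_ne_zero s') by lia. rewrite H0. simpl. lra.
      * assert (Hsn : (0 < s)%nat) by lia. rewrite (pow_ne_zero s) by lia. rewrite H0. simpl. lra.
    + intros g _. rewrite Htri.
      pose proof (cut_size S) as Hc. fold s s' in Hc.
      assert (Hz : INR s * INR s' = 0) by (destruct H0 as [-> | ->]; simpl; ring). rewrite Hz in Hc.
      assert (rsum n (fun i => rsum n (fun j => if Nat.ltb i j then
        (p / 4 - b2R (edge n g i j)) * Rabs (b2R (S i) - b2R (S j)) else 0)) <= 0); [|lra].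
      rewrite <- Hc. apply rsum_le. intros i _. apply rsum_le. intros j _.
      destruct (Nat.ltb i j); [|lra]. pose proof (b2R_bounds (edge n g i j)).
      pose proof (Rabs_pos (b2R (S i) - b2R (S j))). nra.
Qed.

(** From 48 = 8 * 6 comes [r <= n^(-6)], and then the total [2 * ((1 + r)^n - 1)] is at most
    [4 * n * r]. *)
Lemma all_cuts : (2 <= n)%nat -> 48 * ln (INR n) <= INR n * p ->
  whp m0 q (4 * (/ INR n) ^ 5)
   (fun g => forall S : nat -> bool,
      0 <= dirichlet1 n (fun i j => b2R (edge n g i j) - p / 4) (fun i => b2R (S i))).
Proof.
  intros Hn2 Hbig. set (r := exp (- (INR n * p / 8))).
  pose proof (whp_forall_subsets m0 q Hq n _ _ cut_event) as H. fold r in H.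
  assert (HN : 2 <= INR n) by (change 2 with (INR 2); now apply le_INR).
  apply (whp_mono m0 q Hq _ _ _ _ H).
  - rewrite !subset_sum_plus.
    rewrite !(subset_sum_pow n (fun b => b)) by reflexivity.
    rewrite !(subset_sum_pow n negb) by reflexivity.
    rewrite Rplus_0_r, pow1.
    assert (Hr : 0 < r) by apply exp_pos.
    assert (Hr6 : r <= (/ INR n) ^ 6).
    { apply Rle_trans with (exp (- (6 * ln (INR n)))); [apply exp_le_mono; lra|].
      rewrite exp_Ropp, pow_inv. apply Req_le. f_equal.
      replace (6 * ln (INR n)) with (INR 6 * ln (INR n)) by (simpl; lra).
      rewrite <- ln_pow by lra. apply exp_ln. apply pow_lt. lra. }
    assert (Hi : 0 < / INR n <= / 2) by (split; [apply Rinv_0_lt_compat; lra|apply Rinv_le_contravar; lra]).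
    assert (Hnr : INR n * r <= (/ INR n) ^ 5).
    { apply Rle_trans with (INR n * (/ INR n) ^ 6); [apply Rmult_le_compat_l; lra|].
      right. field. lra. }
    assert (H5 : (/ INR n) ^ 5 <= / 2).
    { apply Rle_trans with (/ INR n * 1 ^ 4); [|lra].
      change ((/ INR n) ^ 5) with (/ INR n * (/ INR n) ^ 4).
      apply Rmult_le_compat_l; [lra|]. apply pow_incr. lra. }
    assert (Hpow : (1 + r) ^ n <= 1 + 2 * (INR n * r)).
    { apply Rle_trans with (exp r ^ n).
      - apply pow_incr. pose proof (exp_ineq1_le r). lra.
      - rewrite <- Rpower_pow by apply exp_pos. unfold Rpower. rewrite ln_exp.
        assert (0 <= INR n * r) by (apply Rmult_le_pos; lra).
        eapply Rle_trans; [apply exp_upper; lra|].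
        apply Rmult_le_reg_r with (1 - INR n * r); [lra|]. rewrite Rinv_l by lra. nra. }
    lra.
  (* The union bound enumerates sets that are empty from [n] on; an arbitrary [S] is truncated,
     which changes no term of the sum. *)
  - intros g Hg S. specialize (Hg (fun i => if Nat.ltb i n then S i else false)). simpl in Hg.
    replace (dirichlet1 n _ (fun i => b2R (S i))) with
      (dirichlet1 n (fun i j => b2R (edge n g i j) - p / 4) (fun i => b2R (if Nat.ltb i n then S i else false))).
    + apply Hg. intros i Hi. destruct (Nat.ltb_spec i n); [lia|reflexivity].
    + unfold dirichlet1. apply rsum_ext. intros i Hi. apply rsum_ext. intros j Hj.
      destruct (Nat.ltb_spec i n), (Nat.ltb_spec j n); try lia. reflexivity.
Qed.
End Events.

(** * The good event *)

(** The range tests matter: [gd_f1] and the equality of reduced flows quantify over all indices, and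
    an out-of-range index could alias the bit of another pair. *)
Definition flow (n L : nat) (g : nat -> bool) (i j : nat) : R :=
  if (Nat.ltb i n && Nat.ltb j n && edge n g i j)%bool then yavg n L g i j else 0.

(** Choosing by [epsilon] from the predicate makes the value depend on [drop_vertex m f] alone,
    hence not on the edge bits at [m]. *)
Definition loo_choice (n : nat) (w : nat -> R) (f : nat -> nat -> R) (m : nat) : nat -> R :=
  epsilon (inhabits (fun _ => 0)) (loo_solution n w f m).

Lemma loo_choice_ext n w f f' m : drop_vertex m f = drop_vertex m f' ->
  loo_choice n w f m = loo_choice n w f' m.
Proof. intros E. unfold loo_choice, loo_solution. now rewrite E. Qed.

Lemma yavg_bounds n L g i j : (1 <= L)%nat -> 0 <= yavg n L g i j <= 1.
Proof.
  intros HL. assert (0 < INR L) by (apply lt_0_INR; lia). unfold yavg.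
  assert (H0 : 0 <= rsum L (fun l => b2R (ybit n L g i j l))) by (apply rsum_nonneg; intros; apply b2R_bounds).
  assert (H1 : rsum L (fun l => b2R (ybit n L g i j l)) <= INR L * 1).
  { rewrite <- rsum_const. apply rsum_le. intros; apply b2R_bounds. }
  split; [apply Rmult_le_pos; [easy|left; now apply Rinv_0_lt_compat]|].
  apply Rmult_le_reg_r with (INR L); [easy|]. unfold Rdiv. rewrite Rmult_assoc, Rinv_l; lra.
Qed.

Lemma yavg_antisym n L g i j : (1 <= L)%nat -> i <> j -> yavg n L g i j + yavg n L g j i = 1.
Proof.
  intros HL Hij. assert (0 < INR L) by (apply lt_0_INR; lia). unfold yavg.
  apply Rmult_eq_reg_r with (INR L); [|lra].
  replace (_ * INR L) with (rsum L (fun l => b2R (ybit n L g i j l)) + rsum L (fun l => b2R (ybit n L g j i l)))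
    by (field; lra).
  rewrite <- rsum_plus, (rsum_ext L _ (fun _ => 1)); [rewrite rsum_const; ring|].
  intros l _. rewrite !ybit_cidx by lia. unfold cidx. rewrite (eidx_sym n j i).
  destruct (Nat.ltb_spec i j), (Nat.ltb_spec j i); try lia; destruct (g _); simpl; ring.
Qed.

Lemma flow_edge n L g i j : (i < n)%nat -> (j < n)%nat ->
  flow n L g i j = if edge n g i j then yavg n L g i j else 0.
Proof.
  intros Hi Hj. unfold flow. apply Nat.ltb_lt in Hi, Hj. now rewrite Hi, Hj.
Qed.

Lemma flow_nonneg n L g i j : (1 <= L)%nat -> 0 <= flow n L g i j.
Proof. intros HL. unfold flow. destruct (_ && _)%bool; [now apply yavg_bounds|lra]. Qed.

Lemma flow_sum n L g i j : (1 <= L)%nat -> (i < n)%nat -> (j < n)%nat ->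
  flow n L g i j + flow n L g j i = b2R (edge n g i j).
Proof.
  intros HL Hi Hj. rewrite !flow_edge by easy. rewrite (edge_sym n g j i).
  destruct (Nat.eq_dec i j) as [->|Hij]; [rewrite edge_diag; simpl; ring|].
  destruct (edge n g i j); simpl; [now apply yavg_antisym|ring].
Qed.

Lemma flow_sum_le n L g i j : (1 <= L)%nat -> flow n L g i j + flow n L g j i <= 1.
Proof.
  intros HL. destruct (Nat.ltb_spec i n) as [Hi|Hi]; [destruct (Nat.ltb_spec j n) as [Hj|Hj]|].
  - rewrite flow_sum by easy. apply b2R_bounds.
  - unfold flow. apply Nat.ltb_ge in Hj. rewrite Hj. rewrite !Bool.andb_false_r. simpl. lra.
  - unfold flow. apply Nat.ltb_ge in Hi. rewrite Hi. rewrite !Bool.andb_false_r. simpl. lra.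
Qed.

(** Detailed balance holds at the true probabilities, so the net flow between two items reduces to
    the centred comparison average. *)
Lemma flow_noise n L g w i m : (1 <= L)%nat -> (i < n)%nat -> (m < n)%nat -> i <> m -> 0 < w i -> 0 < w m ->
  w i * flow n L g i m - w m * flow n L g m i =
  if edge n g i m then (w i + w m) * (yavg n L g i m - w m / (w i + w m)) else 0.
Proof.
  intros HL Hi Hm Him Hwi Hwm. rewrite !flow_edge, (edge_sym n g m i) by easy.
  pose proof (yavg_antisym n L g i m HL Him) as Hy.
  destruct (edge n g i m); [|ring].
  replace (yavg n L g m i) with (1 - yavg n L g i m) by lra. field. lra.
Qed.

Lemma stationary_lap n L d g w pi : 0 < d -> (forall i, (i < n)%nat -> 0 < w i) ->
  stationary n (Pmat n L d g) pi ->
  forall m, (m < n)%nat -> lap n w (flow n L g) (fun i => pi i / w i) m = 0.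
Proof.
  intros Hd Hw [_ [_ Hst]] m Hm. specialize (Hst m Hm).
  set (f := flow n L g).
  assert (Hff : f m m = 0) by (unfold f; rewrite flow_edge, edge_diag; easy).
  rewrite (rsum_split n m _ Hm) in Hst. unfold Pmat at 1 in Hst. rewrite Nat.eqb_refl in Hst.
  assert (E1 : rsum n (fun k => if edge n g m k then yavg n L g m k else 0) = rsum n (f m)).
  { apply rsum_ext. intros k Hk. unfold f. now rewrite flow_edge. }
  assert (E2 : rsum n (fun i => if Nat.eqb i m then 0 else pi i * Pmat n L d g i m)
     = / d * rsum n (fun i => pi i * f i m)).
  { rewrite <- rsum_scal. apply rsum_ext. intros i Hi. unfold Pmat.
    destruct (Nat.eqb_spec i m) as [->|]; [rewrite Hff; ring|].
    unfold f. rewrite flow_edge by easy. destruct (edge n g i m); [field; lra|ring]. }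
  rewrite E1, E2 in Hst.
  unfold lap. rewrite (rsum_ext n _ (fun i => pi m * f m i - pi i * f i m)).
  - rewrite rsum_minus, (rsum_scal n (pi m) (f m)).
    apply (Rmult_eq_compat_l d) in Hst. field_simplify in Hst; lra.
  - intros i Hi. specialize (Hw i Hi) as Hwi. specialize (Hw m Hm). field. lra.
Qed.

(** Lets the cut event provide the lower bound on the degrees as well. *)
Lemma singleton_cut n (h : nat -> nat -> R) m : (m < n)%nat -> (forall i j, h i j = h j i) ->
  dirichlet1 n h (fun i => b2R (Nat.eqb i m)) = 2 * rsum n (fun j => if Nat.eqb j m then 0 else h m j).
Proof.
  intros Hm Hs. unfold dirichlet1. rewrite (rsum_split n m _ Hm), Nat.eqb_refl.
  replace (2 * rsum n (fun j => if Nat.eqb j m then 0 else h m j)) with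
    (rsum n (fun j => if Nat.eqb j m then 0 else h m j) + rsum n (fun j => if Nat.eqb j m then 0 else h m j)) by ring.
  f_equal; apply rsum_ext; intros i Hi; destruct (Nat.eqb_spec i m) as [->|Him]; simpl.
  - rewrite Rminus_diag, Rabs_R0. ring.
  - rewrite Rminus_0_r, Rabs_R1. ring.
  - reflexivity.
  - rewrite (rsum_split n m _ Hm), Nat.eqb_refl.
    rewrite (rsum_ext n _ (fun _ => 0)), rsum_0; simpl.
    + rewrite Rminus_0_l, Rabs_Ropp, Rabs_R1, Hs. ring.
    + intros j _. destruct (Nat.eqb j m); [reflexivity|]. simpl. rewrite Rminus_diag, Rabs_R0. ring.
Qed.

Section GoodEvent.
Context (n L : nat) (p K M : R) (w : nat -> R) (Hn : (2 <= n)%nat) (HL : (1 <= L)%nat)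
  (Hp : 0 < p <= 1) (HK : 1 <= K) (Hw : forall i, (i < n)%nat -> 1 <= w i <= K)
  (HM : M = 10000000000 * (K * K * K * K)) (Hbig : 100 * (M * M) * ln (INR n) <= INR n * p).

Let ell := ln (INR n).
Let D := INR n * p.
(** [tau] and [s] serve as exponential parameters for a whole row of about [D] pairs and for a
    single pair respectively; [s * s = tau * tau * D]. *)
Let tau := sqrt (ell / (D * INR L)).
Let s := sqrt (ell / INR L).

Definition noise_below (t : R) (alpha : nat -> R) (beta : nat -> (nat -> bool) -> bool) (bound : R)
    (m : nat) (g : nat -> bool) : Prop :=
  rsum n (fun j => if Nat.eqb j m then 0 else if beta j g then
    INR L * (t * alpha j * (yavg n L g j m - w m / (w j + w m)) - 2 * ((t * alpha j) * (t * alpha j)))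
    else 0) < bound.

Definition degree_below (a : nat -> (nat -> bool) -> R) (m : nat) (g : nat -> bool) : Prop :=
  rsum n (fun j => if Nat.eqb j m then 0 else a j g * b2R (edge n g m j) - 2 * p * a j g) < 6 * ell.

(* Equals 0 when linf is 0, because / 0 = 0. *)
Definition loo_weight (m j : nat) (g : nat -> bool) : R :=
  if Nat.ltb j n then Rabs (loo_choice n w (flow n L g) m j) / linf n (loo_choice n w (flow n L g) m) else 0.

(** The thresholds pay for the union bounds: [6 * ell] for events indexed by one item, [7 * ell] for
    those indexed by two. Signed parameters give two-sided noise bounds. *)
Definition good_event (g : nat -> bool) : Prop :=
  (forall S : nat -> bool,
    0 <= dirichlet1 n (fun i j => b2R (edge n g i j) - p / 4) (fun i => b2R (S i))) /\
  (forall m, (m < n)%nat -> degree_below (fun _ _ => 1) m g) /\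
  (forall m, (m < n)%nat -> degree_below (loo_weight m) m g) /\
  (forall m, (m < n)%nat -> noise_below tau (fun j => w j + w m) (fun j g => edge n g j m) (6 * ell) m g) /\
  (forall m, (m < n)%nat -> noise_below (- tau) (fun j => w j + w m) (fun j g => edge n g j m) (6 * ell) m g) /\
  (forall k, (k < n)%nat -> forall m, (m < n)%nat ->
     noise_below s (fun _ => 1) (fun j _ => Nat.eqb j k) (7 * ell) m g) /\
  (forall k, (k < n)%nat -> forall m, (m < n)%nat ->
     noise_below (- s) (fun _ => 1) (fun j _ => Nat.eqb j k) (7 * ell) m g).

Lemma INR_n : 2 <= INR n.
Proof. change 2 with (INR 2). now apply le_INR. Qed.

Lemma M_large : 10000000000 <= M.
Proof. rewrite HM. assert (1 <= K * K) by nra. assert (1 <= K * K * K) by nra. nra. Qed.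

Lemma ell_half : / 2 <= ell.
Proof.
  pose proof INR_n. pose proof ln_lt_2. unfold ell.
  assert (ln 2 <= ln (INR n)); [|lra]. destruct (Req_dec 2 (INR n)) as [<-|]; [lra|].
  left. apply ln_increasing; lra.
Qed.

Lemma exp_mul_ell k : exp (- (INR k * ell)) = (/ INR n) ^ k.
Proof.
  pose proof INR_n. rewrite exp_Ropp, pow_inv. f_equal. unfold ell.
  rewrite <- ln_pow by lra. apply exp_ln, pow_lt. lra.
Qed.

(** The cuts cost [4 / n^5] and each of the other six families [1 / n^5], which makes 10. *)
Lemma good_event_whp : whp (nvars n L) (bprob n L p w) (10 * (/ INR n) ^ 5) good_event.
Proof.
  pose proof INR_n as HN. pose proof M_large as HML. pose proof ell_half as Hell.
  assert (Hn1 : (1 <= n)%nat) by lia. assert (Hp' : 0 <= p <= 1) by lra.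
  assert (Hw' : forall i, (i < n)%nat -> 0 < w i) by (intros i Hi; specialize (Hw i Hi); lra).
  assert (Hq := bprob_bounds n L p w Hn1 Hp' Hw').
  set (u := / INR n).
  assert (H6 : exp (- (6 * ell)) = u ^ 6) by (rewrite <- exp_mul_ell; simpl (INR 6); do 2 f_equal; ring).
  assert (H7 : exp (- (7 * ell)) = u ^ 7) by (rewrite <- exp_mul_ell; simpl (INR 7); do 2 f_equal; ring).
  (* Edge indices lie below [n * n], so flipping an edge at [m] touches neither the comparison bits
     nor any edge of the reduced graph. *)
  assert (Hdrop : forall g m i b, (m < n)%nat -> (i < n)%nat -> i <> m ->
     loo_choice n w (flow n L (upd g (eidx n m i) b)) m = loo_choice n w (flow n L g) m).
  { intros g m i b Hm Hi Him. apply loo_choice_ext.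
    apply functional_extensionality; intros x. apply functional_extensionality; intros y.
    unfold drop_vertex, flow. destruct (Nat.eqb_spec x m) as [|Hx]; [reflexivity|].
    destruct (Nat.eqb_spec y m) as [|Hy]; [reflexivity|]. simpl.
    destruct (Nat.ltb_spec x n); [|reflexivity]. destruct (Nat.ltb_spec y n); [|reflexivity]. simpl.
    rewrite yavg_upd_edge by (apply eidx_lt; easy).
    rewrite edge_upd; [reflexivity|]. intros E. apply eidx_inj in E; lia. }
  assert (H48 : 48 * ell <= INR n * p).
  { eapply Rle_trans; [|apply Hbig]. fold ell. apply Rmult_le_compat_r; [lra|nra]. }
  assert (A1 := all_cuts n L p w Hn1 HL Hp' Hw' Hn H48).
  assert (A2 : whp (nvars n L) (bprob n L p w) (INR n * u ^ 6)
    (fun g => forall m, (m < n)%nat -> degree_below (fun _ _ => 1) m g)).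
  { apply whp_forall; [easy|]. intros m Hm. rewrite <- H6.
    apply degree_chernoff; auto; [intros; lra|]. intros j i _ _ g k b _. reflexivity. }
  assert (A3 : whp (nvars n L) (bprob n L p w) (INR n * u ^ 6)
    (fun g => forall m, (m < n)%nat -> degree_below (loo_weight m) m g)).
  { apply whp_forall; [easy|]. intros m Hm. rewrite <- H6.
    apply degree_chernoff; auto.
    - intros j g Hj. unfold loo_weight. apply Nat.ltb_lt in Hj as Hj'. rewrite Hj'.
      set (v := loo_choice n w (flow n L g) m). pose proof (linf_ge n v j Hj) as Hle.
      pose proof (Rabs_pos (v j)). destruct (Req_dec (linf n v) 0) as [->|E].
      + unfold Rdiv. rewrite Rinv_0. lra.
      + assert (0 < linf n v) by lra.
        split; [apply Rmult_le_pos; [easy|left; now apply Rinv_0_lt_compat]|].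
        apply Rmult_le_reg_r with (linf n v); [easy|]. unfold Rdiv. rewrite Rmult_assoc, Rinv_l; lra.
    - intros j i Hi Him g k b <-. unfold loo_weight. now rewrite Hdrop. }
  assert (A4 : forall t, whp (nvars n L) (bprob n L p w) (INR n * u ^ 6)
    (fun g => forall m, (m < n)%nat ->
       noise_below t (fun j => w j + w m) (fun j g => edge n g j m) (6 * ell) m g)).
  { intros t. apply (whp_forall _ _ Hq n _
      (fun m g => noise_below t (fun j => w j + w m) (fun j g => edge n g j m) (6 * ell) m g)).
    intros m Hm. rewrite <- H6.
    apply (comparison_hoeffding n L p w Hn1 HL Hp' Hw' m (fun j g => edge n g j m) (fun j => w j + w m)); auto.
    intros j Hj g k b Hk. destruct (Nat.eq_dec j m) as [->|Hjm]; [now rewrite !edge_diag|].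
    rewrite !edge_eidx by easy. apply upd_neq. pose proof (eidx_lt n j m Hj Hm). lia. }
  assert (A5 : forall t, whp (nvars n L) (bprob n L p w) (INR n * (INR n * u ^ 7))
    (fun g => forall k, (k < n)%nat -> forall m, (m < n)%nat ->
       noise_below t (fun _ => 1) (fun j _ => Nat.eqb j k) (7 * ell) m g)).
  { intros t. apply (whp_forall _ _ Hq n _
      (fun k g => forall m, (m < n)%nat -> noise_below t (fun _ => 1) (fun j _ => Nat.eqb j k) (7 * ell) m g)).
    intros k Hk. apply (whp_forall _ _ Hq n _
      (fun m g => noise_below t (fun _ => 1) (fun j _ => Nat.eqb j k) (7 * ell) m g)).
    intros m Hm. rewrite <- H7.
    apply (comparison_hoeffding n L p w Hn1 HL Hp' Hw' m (fun j _ => Nat.eqb j k) (fun _ => 1)); auto.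
    intros j _ g b c _. reflexivity. }
  pose proof (whp_and _ _ Hq _ _ _ _ A1 (whp_and _ _ Hq _ _ _ _ A2 (whp_and _ _ Hq _ _ _ _ A3
    (whp_and _ _ Hq _ _ _ _ (A4 tau) (whp_and _ _ Hq _ _ _ _ (A4 (- tau))
    (whp_and _ _ Hq _ _ _ _ (A5 s) (A5 (- s)))))))) as A.
  apply (whp_mono _ _ Hq _ _ _ _ A); [|intros g Hg; exact Hg].
  right. fold u. unfold u. field. lra.
Qed.

Lemma D_pos : M <= D /\ M * M <= D /\ D <= INR n.
Proof.
  pose proof M_large. pose proof ell_half. pose proof INR_n. fold ell D in Hbig.
  assert (H2 : M * M <= 100 * (M * M) * ell) by nra. assert (M <= M * M) by nra.
  repeat split; [lra|lra|]. unfold D. nra.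
Qed.

Lemma tau_props : 0 < tau /\ 10 * M * tau <= 1 /\ tau * tau * (D * INR L) = ell /\ s * s = tau * tau * D /\ 0 < s.
Proof.
  pose proof M_large. pose proof ell_half. destruct D_pos as [H1 [H2 H3]].
  assert (HLp : 1 <= INR L) by (change 1 with (INR 1); now apply le_INR).
  assert (HDL : 0 < D * INR L) by nra.
  assert (Hq : 0 < ell / (D * INR L)) by (apply Rmult_lt_0_compat; [lra|now apply Rinv_0_lt_compat]).
  assert (Ht : tau * tau = ell / (D * INR L)) by (apply sqrt_sqrt; lra).
  assert (Ht0 : 0 < tau) by now apply sqrt_lt_R0.
  assert (Hq' : 0 < ell / INR L) by (apply Rmult_lt_0_compat; [lra|apply Rinv_0_lt_compat; lra]).
  assert (Hs : s * s = ell / INR L) by (apply sqrt_sqrt; lra).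
  split; [easy|]. split; [|split; [rewrite Ht; field; lra|split; [rewrite Hs, Ht; field; lra|now apply sqrt_lt_R0]]].
  assert (E : tau * tau * (D * INR L) = ell) by (rewrite Ht; field; lra).
  assert (Hle : 100 * (M * M) * (tau * tau) <= 1).
  { apply Rmult_le_reg_r with (D * INR L); [easy|].
    replace (100 * (M * M) * (tau * tau) * (D * INR L)) with (100 * (M * M) * (tau * tau * (D * INR L))) by ring.
    rewrite E. fold ell D in Hbig. nra. }
  destruct (Rle_lt_dec (10 * M * tau) 1) as [|Hlt]; [easy|]. nra.
Qed.

(** Above, Chernoff gives [2 * D + 6 * ell <= 3 * D]; below, the cut around [m] gives
    [(n - 1) * p / 4], at least [D / 8] since [n >= 2]. *)
Lemma good_degree g m : good_event g -> (m < n)%nat ->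
  D / 8 <= rsum n (fun j => b2R (edge n g m j)) <= 3 * D.
Proof.
  intros [Hcut [Hdeg _]] Hm. pose proof INR_n. destruct D_pos as [_ [HMD _]].
  assert (H6 : 6 * ell <= D).
  { fold ell D in Hbig. pose proof M_large. pose proof ell_half.
    assert (6 * ell <= 100 * (M * M) * ell); [|lra]. apply Rmult_le_compat_r; [lra|nra]. }
  split.
  - specialize (Hcut (fun i => Nat.eqb i m)). cbv beta in Hcut. rewrite singleton_cut in Hcut.
    + rewrite (rsum_split n m _ Hm), edge_diag. simpl.
      assert (E : rsum n (fun j => if Nat.eqb j m then 0 else b2R (edge n g m j) - p / 4) =
        rsum n (fun j => if Nat.eqb j m then 0 else b2R (edge n g m j)) - (INR n - 1) * (p / 4)).
      { replace ((INR n - 1) * (p / 4)) with (rsum n (fun j => if Nat.eqb j m then 0 else p / 4)).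
        - rewrite <- rsum_minus. apply rsum_ext. intros j _. destruct (Nat.eqb j m); ring.
        - pose proof (rsum_split n m (fun _ => p / 4) Hm) as E. rewrite rsum_const in E. lra. }
      rewrite E in Hcut. unfold D. nra.
    + easy.
    + intros i j. now rewrite edge_sym.
  - specialize (Hdeg m Hm). unfold degree_below in Hdeg.
    assert (rsum n (fun j => b2R (edge n g m j) - 2 * p) <= 6 * ell).
    { eapply Rle_trans; [|left; apply Hdeg]. apply rsum_le. intros j _.
      destruct (Nat.eqb_spec j m) as [->|]; [rewrite edge_diag; simpl; lra|lra]. }
    rewrite rsum_minus, rsum_const in H0. unfold D in *. lra.
Qed.

(** Division by [INR L * k] in the Chernoff bounds for [k] and [- k]: the first term is the
    threshold, the second the compensator of at most [B] selected terms. *)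
Lemma noise_abs_bound alpha beta B b k A m g : (forall j, (j < n)%nat -> Rabs (alpha j) <= A) -> 0 < k ->
  rsum n (fun j => b2R (beta j g)) <= B ->
  noise_below k alpha beta b m g -> noise_below (- k) alpha beta b m g ->
  Rabs (rsum n (fun j => if Nat.eqb j m then 0 else if beta j g then
    alpha j * (yavg n L g j m - w m / (w j + w m)) else 0)) <= b / (INR L * k) + 2 * k * (A * A) * B.
Proof.
  intros HA Hk HB Hp1 Hm1.
  assert (HLp : 1 <= INR L) by (change 1 with (INR 1); now apply le_INR).
  set (X := rsum n _).
  assert (HX : forall t, t * t = k * k -> noise_below t alpha beta b m g ->
     INR L * t * X <= b + 2 * (INR L * (k * k) * (A * A) * B)).
  { intros t Ht Hb. unfold noise_below in Hb.
    assert (H2 : INR L * t * X - 2 * (INR L * (k * k) * (A * A)) * rsum n (fun j => b2R (beta j g)) <= b).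
    { eapply Rle_trans; [|left; apply Hb]. unfold X. rewrite <- !rsum_scal, <- rsum_minus.
      apply rsum_le. intros j Hj. specialize (HA j Hj).
      assert (Haa : alpha j * alpha j <= A * A).
      { replace (alpha j * alpha j) with (Rabs (alpha j) * Rabs (alpha j))
          by (unfold Rabs; destruct Rcase_abs; ring).
        pose proof (Rabs_pos (alpha j)). apply Rmult_le_compat; lra. }
      assert (0 <= INR L * (k * k)) by (apply Rmult_le_pos; nra).
      assert (0 <= INR L * (k * k) * (A * A)) by (apply Rmult_le_pos; nra).
      destruct (Nat.eqb j m); [pose proof (b2R_bounds (beta j g)); nra|].
      destruct (beta j g); simpl; [|lra].
      replace (t * alpha j * (t * alpha j)) with ((t * t) * (alpha j * alpha j)) by ring. rewrite Ht.
      assert (INR L * (k * k) * (alpha j * alpha j) <= INR L * (k * k) * (A * A))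
        by (apply Rmult_le_compat_l; lra).
      lra. }
    assert (INR L * (k * k) * (A * A) * rsum n (fun j => b2R (beta j g)) <= INR L * (k * k) * (A * A) * B).
    { apply Rmult_le_compat_l; [|easy]. apply Rmult_le_pos; [apply Rmult_le_pos|]; nra. }
    lra. }
  pose proof (HX k eq_refl Hp1) as U1. pose proof (HX (- k) ltac:(ring) Hm1) as U2.
  assert (HLk : 0 < INR L * k) by nra.
  assert (E : INR L * k * (b / (INR L * k) + 2 * k * (A * A) * B) = b + 2 * (INR L * (k * k) * (A * A) * B))
    by (field; lra).
  apply Rabs_le. split; apply Rmult_le_reg_l with (INR L * k); try easy; lra.
Qed.

Lemma good_event_data g : good_event g -> good_data n K M D tau w (flow n L g).
Proof.
  intros Hg. pose proof INR_n. pose proof M_large. pose proof ell_half as Hell.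
  destruct D_pos as [HMD [HM2 HDn]]. destruct tau_props as [Ht0 [HtM [Ht [Hs Hs0]]]].
  assert (HLp : 1 <= INR L) by (change 1 with (INR 1); now apply le_INR).
  assert (Hw' : forall i, (i < n)%nat -> 0 < w i) by (intros i Hi; specialize (Hw i Hi); lra).
  pose proof (good_degree g) as Hdeg.
  specialize (fun m => Hdeg m Hg).
  destruct Hg as [Hcut [Hd [Hl [Hr1 [Hr2 [Hp1 Hp2]]]]]].
  constructor; auto.
  - lra.
  - apply Rle_trans with (sqrt (M * M)); [rewrite sqrt_square; lra|apply sqrt_le_1_alt; lra].
  - intros i j. now apply flow_nonneg.
  - intros i j. now apply flow_sum_le.
  - intros m Hm. rewrite (rsum_ext n _ (fun j => b2R (edge n g m j))); [auto|].
    intros j Hj. now apply flow_sum.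
  - intros z Hz.
    rewrite (rsum_ext n (fun i => rsum n (fun j => (flow n L g i j + flow n L g j i) * _))
      (fun i => rsum n (fun j => b2R (edge n g i j) * ((z i - z j) * (z i - z j))))).
    2: { intros i Hi. apply rsum_ext. intros j Hj. now rewrite flow_sum. }
    apply (cheeger n (fun i j => b2R (edge n g i j)) D p); auto; [lra| | |].
    + intros i j. now rewrite edge_sym.
    + intros i j. apply b2R_bounds.
    + intros i Hi. now apply Hdeg.
  - intros m Hm.
    assert (E : lap n w (flow n L g) (fun _ => 1) m = - rsum n (fun j => if Nat.eqb j m then 0 else
      if edge n g j m then (w j + w m) * (yavg n L g j m - w m / (w j + w m)) else 0)).
    { unfold lap. replace (- rsum n _) with (-1 * rsum n (fun j => if Nat.eqb j m then 0 else
      if edge n g j m then (w j + w m) * (yavg n L g j m - w m / (w j + w m)) else 0)) by ring.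
      rewrite <- rsum_scal. apply rsum_ext. intros i Hi.
      destruct (Nat.eqb_spec i m) as [->|Him]; [ring|].
      rewrite <- (flow_noise n L g w i m) by auto. ring. }
    rewrite E, Rabs_Ropp.
    eapply Rle_trans; [apply (noise_abs_bound (fun j => w j + w m) (fun j g => edge n g j m)
      (3 * D) (6 * ell) tau (2 * K) m g); auto|].
    + intros j Hj. pose proof (Hw j Hj). pose proof (Hw m Hm). rewrite Rabs_right; lra.
    + rewrite (rsum_ext n _ (fun j => b2R (edge n g m j))) by (intros; now rewrite edge_sym).
      now apply Hdeg.
    (* The threshold contributes [6 * D * tau] and the compensator [2 * tau * (2 * K)^2 * 3 * D],
       that is 6 + 24 = 30. *)
    + replace (6 * ell / (INR L * tau)) with (6 * D * tau) by (rewrite <- Ht; field; lra).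
      assert (0 <= (K * K - 1) * (D * tau)) by (apply Rmult_le_pos; nra). lra.
  - intros m Hm.
    (* A selector concentrated on one item reduces the sum to one pair: [7 * s] from the threshold
       plus [2 * s] from the compensator. *)
    assert (Hpair : forall k, (k < n)%nat -> k <> m -> Rabs (yavg n L g k m - w m / (w k + w m)) <= 9 * s).
    { intros k Hk Hkm. pose proof (noise_abs_bound (fun _ => 1) (fun j _ => Nat.eqb j k) 1 (7 * ell) s 1 m g) as Hb.
      assert (E1 : rsum n (fun j => b2R (Nat.eqb j k)) = 1).
      { rewrite (rsum_split n k _ Hk), Nat.eqb_refl, (rsum_ext n _ (fun _ => 0)), rsum_0; [simpl; ring|].
        intros j _. now destruct (Nat.eqb j k). }
      rewrite (rsum_split n k (fun j => if Nat.eqb j m then 0 else _) Hk) in Hb.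
      rewrite Nat.eqb_refl in Hb. destruct (Nat.eqb_spec k m) as [|_]; [easy|].
      rewrite (rsum_ext n (fun i => if Nat.eqb i k then 0 else _) (fun _ => 0)), rsum_0 in Hb.
      2: { intros j _. destruct (Nat.eqb j k), (Nat.eqb j m); reflexivity. }
      rewrite Rplus_0_r, Rmult_1_l in Hb.
      eapply Rle_trans; [apply Hb; auto|].
      - intros. rewrite Rabs_R1. lra.
      - lra.
      - replace (7 * ell / (INR L * s)) with (7 * s); [lra|].
        rewrite <- Ht. replace (tau * tau * (D * INR L)) with (tau * tau * D * INR L) by ring.
        rewrite <- Hs. field. lra. }
    apply norm2_le; [assert (0 <= D * tau) by nra; nra|].
    (* Here 324 is the square of [2 * 9]; at most [3 * D] neighbours give 972, below the square of
       32. *)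
    apply Rle_trans with (rsum n (fun k => 324 * (K * K) * (s * s) * b2R (edge n g m k))).
    + apply rsum_le. intros k Hk. destruct (Nat.eq_dec k m) as [->|Hkm].
      * rewrite Rminus_diag, edge_diag. simpl. lra.
      * rewrite flow_noise by auto. rewrite (edge_sym n g m k).
        destruct (edge n g k m); simpl; [|lra].
        specialize (Hpair k Hk Hkm). set (e := yavg n L g k m - _) in *.
        replace ((w k + w m) * e * ((w k + w m) * e)) with (((w k + w m) * (w k + w m)) * (Rabs e * Rabs e))
          by (unfold Rabs; destruct Rcase_abs; ring).
        pose proof (Hw k Hk). pose proof (Hw m Hm). pose proof (Rabs_pos e).
        apply Rle_trans with ((2 * K * (2 * K)) * (9 * s * (9 * s))); [|lra].
        apply Rmult_le_compat; try (apply Rmult_le_compat; lra); try (apply Rmult_le_pos; lra).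
    + rewrite rsum_scal. destruct (Hdeg m Hm) as [_ Hup].
      apply Rle_trans with (324 * (K * K) * (s * s) * (3 * D)).
      * apply Rmult_le_compat_l; [|easy]. repeat apply Rmult_le_pos; lra.
      * rewrite Hs. assert (0 <= (K * K) * (D * D) * (tau * tau)) by (repeat apply Rmult_le_pos; lra). lra.
Qed.

Lemma good_event_loo g m : good_event g -> (m < n)%nat ->
  let eta := loo_choice n w (flow n L g) m in
  rsum n (fun k => (flow n L g m k + flow n L g k m) * Rabs (eta k))
    <= 2 * p * rsum n (fun k => Rabs (eta k)) + 6 * ell * linf n eta.
Proof.
  intros Hg Hm eta. destruct Hg as [_ [_ [Hl _]]]. specialize (Hl m Hm). unfold degree_below in Hl.
  pose proof (linf_nonneg n eta) as HH. apply Rlt_le, (Rmult_le_compat_l (linf n eta)) in Hl; [|easy].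
  assert (Ha : forall j, (j < n)%nat -> linf n eta * loo_weight m j g = Rabs (eta j)).
  { intros j Hj. unfold loo_weight. apply Nat.ltb_lt in Hj as Hj'. rewrite Hj'. fold eta.
    destruct (Req_dec (linf n eta) 0) as [E|E]; [|field; easy].
    pose proof (linf_ge n eta j Hj). pose proof (Rabs_pos (eta j)). rewrite E in *. lra. }
  assert (H : rsum n (fun k => (flow n L g m k + flow n L g k m) * Rabs (eta k) - 2 * p * Rabs (eta k))
     <= linf n eta * (6 * ell)).
  { eapply Rle_trans; [|apply Hl]. rewrite <- rsum_scal. apply rsum_le. intros j Hj.
    rewrite flow_sum, <- (Ha j Hj) by easy. pose proof (Ha j Hj). pose proof (Rabs_pos (eta j)).
    destruct (Nat.eqb_spec j m) as [->|]; [rewrite edge_diag; simpl; nra|].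
    right. ring. }
  rewrite rsum_minus, rsum_scal in H. lra.
Qed.

Lemma good_event_error g pi d : good_event g -> 0 < d -> stationary n (Pmat n L d g) pi ->
  linf n (fun i => pi i - pistar n w i) / linf n (pistar n w) <= 6 * M * tau.
Proof.
  intros Hg Hd Hst. pose proof INR_n as HN. pose proof (good_event_data g Hg) as gd.
  pose proof M_large as HML. pose proof ell_half as Hell.
  destruct D_pos as [HMD [HM2 HDn]]. destruct tau_props as [Ht0 [HtM _]].
  assert (Hw' : forall i, (i < n)%nat -> 0 < w i) by (intros i Hi; specialize (Hw i Hi); lra).
  pose proof (stationary_lap n L d g w pi Hd Hw' Hst) as Hlap.
  destruct Hst as [Hpos [Hsum _]].
  set (S0 := rsum n (fun i => pi i / w i)).
  assert (HS0 : 0 < S0).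
  (* [w <= K] and the normalization of [pi] keep the rescaling factor [INR n / S0] finite. *)
  { assert (1 <= K * S0); [|nra]. rewrite <- Hsum. unfold S0. rewrite <- rsum_scal. apply rsum_le.
    intros i Hi. specialize (Hpos i Hi). destruct (Hw i Hi).
    apply Rmult_le_reg_r with (w i); [lra|]. replace (K * (pi i / w i) * w i) with (K * pi i) by (field; lra).
    nra. }
  set (x := fun i => INR n / S0 * (pi i / w i)).
  assert (Hx : forall m, (m < n)%nat -> Rabs (x m - 1) <= 2 * M * tau).
  { apply (linf_error n K M D tau w (flow n L g) x ell p (loo_choice n w (flow n L g)) gd eq_refl).
    - lra.
    - fold ell D in Hbig. eapply Rle_trans; [|apply Hbig]. apply Rmult_le_compat_r; [lra|nra].
    - intros k Hk. rewrite (lap_lin n w _ (INR n / S0) 0 (fun i => pi i / w i) (fun i => pi i / w i) x k Hk)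
        by (intros; unfold x; ring). rewrite Hlap by easy. ring.
    - unfold x. rewrite rsum_scal. fold S0. field. lra.
    - intros m Hm. unfold loo_choice. apply epsilon_spec.
      now apply (loo_solution_exists n K M D tau w (flow n L g) m gd).
    - intros m Hm. now apply good_event_loo. }
  set (eps := 2 * M * tau) in *. set (W := rsum n w).
  assert (HW : 0 < W).
  { apply Rlt_le_trans with (w 0%nat); [apply Hw'; lia|].
    apply rsum_term_le; [lia|]. intros i Hi. left. now apply Hw'. }
  assert (Hbd : forall i, (i < n)%nat -> 1 - eps <= x i <= 1 + eps).
  { intros i Hi. specialize (Hx i Hi). pose proof (Rle_abs (x i - 1)).
    pose proof (Rle_abs (- (x i - 1))) as Hneg. rewrite Rabs_Ropp in Hneg. lra. }
  (* Passing from total [n] for [x] to total 1 for [pi] leaves the factor [V] in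
     [pi i = x i * V * pistar i]. Both normalizations give [V * (1 - eps) <= 1 <= V * (1 + eps)];
     with [eps <= / 5] the relative error is at most [3 * eps]. *)
  set (V := S0 / INR n * W).
  assert (HV : S0 / INR n * rsum n (fun i => w i * x i) = 1).
  { rewrite <- Hsum, <- rsum_scal. apply rsum_ext. intros i Hi. unfold x.
    specialize (Hw' i Hi). field. lra. }
  assert (HSn : 0 < S0 / INR n) by (apply Rmult_lt_0_compat; [easy|apply Rinv_0_lt_compat; lra]).
  assert (HV0 : 0 < V) by now apply Rmult_lt_0_compat.
  assert (Hlow : (1 - eps) * W <= rsum n (fun i => w i * x i)).
  { unfold W. rewrite <- rsum_scal. apply rsum_le. intros i Hi.
    specialize (Hw' i Hi). destruct (Hbd i Hi). rewrite Rmult_comm. apply Rmult_le_compat_l; lra. }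
  assert (Hupp : rsum n (fun i => w i * x i) <= (1 + eps) * W).
  { unfold W. rewrite <- rsum_scal. apply rsum_le. intros i Hi.
    specialize (Hw' i Hi). destruct (Hbd i Hi). rewrite (Rmult_comm (1 + eps)). apply Rmult_le_compat_l; lra. }
  apply (Rmult_le_compat_l (S0 / INR n)) in Hlow, Hupp; try lra. rewrite HV in Hlow, Hupp.
  assert (HV1 : V * (1 - eps) <= 1) by (unfold V; lra).
  assert (HV2 : 1 <= V * (1 + eps)) by (unfold V; lra).
  assert (Heps : 0 <= eps <= / 5) by (unfold eps; split; [repeat apply Rmult_le_pos; lra|lra]).
  assert (Hlp : 0 < linf n (pistar n w)).
  { eapply Rlt_le_trans; [|apply (linf_ge n (pistar n w) 0%nat); lia].
    apply Rabs_pos_lt. unfold pistar. fold W. pose proof (Hw' 0%nat ltac:(lia)).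
    apply Rgt_not_eq, Rmult_lt_0_compat; [easy|now apply Rinv_0_lt_compat]. }
  apply Rmult_le_reg_r with (linf n (pistar n w)); [easy|].
  unfold Rdiv at 1. rewrite Rmult_assoc, Rinv_l, Rmult_1_r by lra.
  replace (6 * M * tau) with (3 * eps) by (unfold eps; ring).
  apply linf_le; [apply Rmult_le_pos; lra|]. intros i Hi.
  replace (pi i - pistar n w i) with ((x i * V - 1) * pistar n w i).
  2: { unfold x, V, pistar. fold W. specialize (Hw' i Hi). field. lra. }
  rewrite Rabs_mult. apply Rmult_le_compat; try apply Rabs_pos; [|now apply linf_ge].
  destruct (Hbd i Hi) as [Hx1 Hx2].
  assert (V * eps <= V * / 5) by (apply Rmult_le_compat_l; lra).
  assert (HVe : V * eps <= 5 / 4 * eps) by (apply Rmult_le_compat_r; lra).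
  apply (Rmult_le_compat_r V) in Hx1, Hx2; try lra. apply Rabs_le. split; lra.
Qed.
End GoodEvent.

(** * Invariance under scaling of the scores, and the final bound *)

Lemma bprob_scale n L p c w v : (1 <= n)%nat -> 0 < c ->
  (forall i, (i < n)%nat -> 0 < v i) -> (forall i, (i < n)%nat -> w i = c * v i) ->
  bprob n L p w = bprob n L p v.
Proof.
  intros Hn Hc Hv Hwv. apply functional_extensionality; intros k. unfold bprob. cbv zeta.
  destruct (Nat.ltb k (n * n)); [reflexivity|].
  set (j := Nat.modulo _ n). set (i := Nat.div _ n).
  destruct (Nat.ltb_spec i j); [|reflexivity].
  assert (Hj : (j < n)%nat) by (apply Nat.mod_upper_bound; lia).
  rewrite (Hwv i), (Hwv j) by lia. pose proof (Hv i ltac:(lia)). pose proof (Hv j Hj).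
  rewrite <- Rmult_plus_distr_l. field. lra.
Qed.

Lemma pistar_scale n c w v i : 0 < c -> (i < n)%nat -> 0 < rsum n v ->
  (forall i, (i < n)%nat -> w i = c * v i) -> pistar n w i = pistar n v i.
Proof.
  intros Hc Hi Hv Hwv. unfold pistar.
  rewrite (rsum_ext n w (fun i => c * v i)), rsum_scal, Hwv by easy. field. lra.
Qed.

Lemma linf_ext n u v : (forall i, (i < n)%nat -> u i = v i) -> linf n u = linf n v.
Proof.
  induction n as [|n IH]; intros H; simpl; [reflexivity|].
  rewrite IH by (intros; apply H; lia). now rewrite H by lia.
Qed.

Theorem theorem3 :
  forall (kappa0 c_d : R), 1 <= kappa0 -> 2 <= c_d ->
  exists c0 : R, 0 < c0 /\
  exists C : R, 0 < C /\
  exists C' : R, 0 < C' /\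
  forall (n L : nat) (w : nat -> R) (wmin wmax p : R),
    (1 <= n)%nat -> (1 <= L)%nat ->
    0 < wmin ->
    (forall i, (i < n)%nat -> wmin <= w i <= wmax) ->
    (forall i j, (i <= j < n)%nat -> w j <= w i) ->
    wmax / wmin <= kappa0 ->
    c0 * ln (INR n) / INR n < p -> p <= 1 ->
    let d := c_d * INR n * p in
    bexp (nvars n L) (bprob n L p w)
      (fun g => indic (forall pi : nat -> R,
          stationary n (Pmat n L d g) pi ->
          linf n (fun i => pi i - pistar n w i) / linf n (pistar n w)
            <= C * sqrt (ln (INR n) / (INR n * p * INR L))))
    >= 1 - C' * / (INR n ^ 5).
Proof.
  intros K c_d HK Hcd.
  set (M := 10000000000 * (K * K * K * K)).
  assert (HM0 : 0 < M).
  { unfold M. assert (1 <= K * K) by nra. assert (1 <= K * K * K) by nra. nra. }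
  (* [100 * M^2] yields [10 * M * tau <= 1]; [6 * M] is three times the [2 * M] of [linf_error]; 10
     is the constant of [good_event_whp]. *)
  exists (100 * (M * M)). split; [nra|]. exists (6 * M). split; [lra|]. exists 10. split; [lra|].
  intros n L w wmin wmax p Hn HL Hwm Hw _ Hkap Hc0 Hp1 d.
  (* The comparison probabilities and [pistar] see only ratios of scores, so the smallest score may
     be taken as 1 and all of them in [[1, K]]. *)
  set (v := fun i => w i / wmin).
  assert (Hwv : forall i, (i < n)%nat -> w i = wmin * v i) by (intros; unfold v; field; lra).
  assert (Hv : forall i, (i < n)%nat -> 1 <= v i <= K).
  { intros i Hi. destruct (Hw i Hi) as [H1 H2]. unfold v. split.
    - apply Rmult_le_reg_r with wmin; [easy|]. unfold Rdiv. rewrite Rmult_assoc, Rinv_l; lra.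
    - eapply Rle_trans; [|apply Hkap]. apply Rmult_le_compat_r; [left; now apply Rinv_0_lt_compat|easy]. }
  assert (Hv0 : forall i, (i < n)%nat -> 0 < v i) by (intros i Hi; specialize (Hv i Hi); lra).
  assert (HN : 1 <= INR n) by (change 1 with (INR 1); now apply le_INR).
  assert (Hln : 0 <= ln (INR n)).
  { destruct HN as [HN|<-]; [|rewrite ln_1; lra]. left. rewrite <- ln_1. apply ln_increasing; lra. }
  assert (Hp0 : 0 < p).
  { eapply Rle_lt_trans; [|apply Hc0]. apply Rmult_le_pos; [|left; apply Rinv_0_lt_compat; lra].
    apply Rmult_le_pos; nra. }
  rewrite (bprob_scale n L p wmin w v Hn Hwm Hv0 Hwv).
  pose proof (bprob_bounds n L p v Hn ltac:(lra) Hv0) as Hq.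
  (* For one item the claimed probability bound is [1 - 10], which is negative. *)
  destruct (Nat.eq_dec n 1) as [E1|Hn1].
  { apply Rle_ge, Rle_trans with 0.
    - rewrite E1. simpl. lra.
    - rewrite <- (bexp_const (nvars n L) (bprob n L p v) 0). apply bexp_mono; [easy|].
      intros g. apply indic_bounds. }
  assert (Hbig : 100 * (M * M) * ln (INR n) <= INR n * p).
  { apply (Rmult_lt_compat_l (INR n)) in Hc0; [|lra].
    replace (INR n * (100 * (M * M) * ln (INR n) / INR n)) with (100 * (M * M) * ln (INR n)) in Hc0
      by (field; lra). lra. }
  apply whp_bexp. apply (whp_mono _ _ Hq _ _ _ _
    (good_event_whp n L p K M v ltac:(lia) HL ltac:(lra) HK Hv eq_refl Hbig)).
  - rewrite pow_inv. lra.
  - intros g Hg pi Hst.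
    assert (HW : 0 < rsum n v).
    { apply Rlt_le_trans with (v 0%nat); [apply Hv0; lia|].
      apply rsum_term_le; [lia|]. intros i Hi. left. now apply Hv0. }
    rewrite (linf_ext n (pistar n w) (pistar n v)), (linf_ext n (fun i => pi i - pistar n w i)
      (fun i => pi i - pistar n v i)) by (intros; now rewrite (pistar_scale n wmin w v)).
    apply (good_event_error n L p K M v ltac:(lia) HL ltac:(lra) HK Hv eq_refl Hbig g pi d Hg); [|easy].
    unfold d. apply Rmult_lt_0_compat; [apply Rmult_lt_0_compat|]; lra.
Qed.
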